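(* TAP restricted to instances that are simultaneously $2$-occurrence and $2$-weight is solvable exactly in polynomial time.
   Context: Target Approximation Problem (TAP): the input is a groundset $U=\{1,\dots,n\}$ of features, a target $T\subseteq U$, and a collection $S=\{E_1,\dots,E_m\}$ of exemplars, each $E_j\subseteq U$. Features in $U\cap T$ are blue, features in $U\setminus T$ are red. A feature appears in $S'\subseteq S$ if it lies in $\bigcup_{E\in S'}E$. The margin of $S'$ is (number of blue features appearing in $S'$) minus (number of red features appearing in $S'$); TAP asks for $S'$ of maximum margin. It is assumed that every feature appears in at least one exemplar and that $T$ and all exemplars are nonempty. An instance is $k$-occurrence if every feature belongs to at most $k$ exemplars, and $w$-weight if every exemplar contains at most $w$ features. *)

(* Defs.v *)
From mathcomp Require Import all_boot all_order all_algebra.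
Set Implicit Arguments. Unset Strict Implicit. Unset Printing Implicit Defensive.
Import GRing.Theory Num.Theory.

(* Target Approximation Problem (TAP).                                  *)
(* Features are 'I_n (i.e. {0,..,n-1} instead of {1,..,n}), exemplars   *)
(* are indexed by 'I_m, exemplar j is the set S j, the target is T.     *)

Definition appearing (n m : nat) (S : 'I_m -> {set 'I_n}) (S' : {set 'I_m})
  : {set 'I_n} := \bigcup_(j in S') S j.

Definition margin (n m : nat) (T : {set 'I_n}) (S : 'I_m -> {set 'I_n})
  (S' : {set 'I_m}) : int :=
  (#|appearing S S' :&: T|%:Z - #|appearing S S' :\: T|%:Z)%R.

Definition optimal (n m : nat) (T : {set 'I_n}) (S : 'I_m -> {set 'I_n})
  (S' : {set 'I_m}) : Prop :=
  forall S'' : {set 'I_m}, (margin T S S'' <= margin T S S')%R.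

Definition valid_instance (n m : nat) (T : {set 'I_n}) (S : 'I_m -> {set 'I_n})
  : Prop :=
  [/\ forall i : 'I_n, exists j : 'I_m, i \in S j,
      T != set0 &
      forall j : 'I_m, S j != set0].

Definition k_occurrence (k n m : nat) (S : 'I_m -> {set 'I_n}) : Prop :=
  forall i : 'I_n, #|[set j : 'I_m | i \in S j]| <= k.

Definition w_weight (w n m : nat) (S : 'I_m -> {set 'I_n}) : Prop :=
  forall j : 'I_m, #|S j| <= w.

(* Model of computation: unit-cost RAM with addition, truncated         *)
(* subtraction, constants, indirect addressing and conditional jumps    *)
(* (polynomially equivalent to Turing machines, Cook-Reckhow).          *)

Inductive instr : Type :=
| IConst of nat & nat          (* IConst r v   : M[r] := v              *)
| IAdd of nat & nat & nat      (* IAdd r a b   : M[r] := M[a] + M[b]    *)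
| ISub of nat & nat & nat      (* ISub r a b   : M[r] := M[a] - M[b]    *)
| ILoad of nat & nat           (* ILoad r a    : M[r] := M[M[a]]        *)
| IStore of nat & nat          (* IStore a r   : M[M[a]] := M[r]        *)
| IJz of nat & nat             (* IJz r l      : if M[r] = 0 goto l     *)
| IJmp of nat.                 (* IJmp l       : goto l                 *)

Definition memory := nat -> nat.

Definition upd (M : memory) (r v : nat) : memory :=
  fun x => if x == r then v else M x.

Definition step (p : seq instr) (pc : nat) (M : memory) : nat * memory :=
  match nth (IJmp 0) p pc with
  | IConst r v => (pc.+1, upd M r v)
  | IAdd r a b => (pc.+1, upd M r (M a + M b))
  | ISub r a b => (pc.+1, upd M r (M a - M b))
  | ILoad r a => (pc.+1, upd M r (M (M a)))
  | IStore a r => (pc.+1, upd M (M a) (M r))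
  | IJz r l => (if M r == 0 then l else pc.+1, M)
  | IJmp l => (l, M)
  end.

Fixpoint run (fuel : nat) (p : seq instr) (pc : nat) (M : memory)
  : option memory :=
  if size p <= pc then Some M else
  match fuel with
  | 0 => None
  | f.+1 => let: (pc', M') := step p pc M in run f p pc' M'
  end.

(* Input encoding of an instance: M[0] = n, M[1] = m,
   M[2+i] = [i \in T] for i < n,
   M[2+n+j*n+i] = [i \in S j] for j < m, i < n, all other cells 0. *)
Definition encode (n m : nat) (T : {set 'I_n}) (S : 'I_m -> {set 'I_n})
  : memory :=
  fun x =>
    if x == 0 then n else
    if x == 1 then m else
    if x < 2 + n then
      (if insub (x - 2) is Some i then nat_of_bool (i \in T) else 0) else
    if x < 2 + n + m * n then
      (let y := x - (2 + n) in
       match insub (y %/ n), insub (y %% n) with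
       | Some j, Some i => nat_of_bool (i \in S j)
       | _, _ => 0
       end)
    else 0.

Definition decode (m : nat) (M : memory) : {set 'I_m} :=
  [set j : 'I_m | M (nat_of_ord j) != 0].

(* Main.v *)
Require Import Defs.
From mathcomp Require Import all_boot all_order all_algebra.
From mathcomp Require Import zify.
Set Implicit Arguments. Unset Strict Implicit. Unset Printing Implicit Defensive.

(** A red-blue exemplar [{b, r}] is only useful next to the other exemplar
    containing [r]: exemplars without red are always taken, exemplars without
    blue never, and two mixed exemplars sharing their red feature gain exactly 1
    when their blue features are distinct and otherwise uncovered.  With
    occurrence and weight at most 2, the mixed exemplars carry two partial
    involutions, [p] (same red) and [q] (same blue), and an optimal solution is a
    largest set of [p]-pairs no two of which are linked by [q]: a maximum
    matching in a graph whose components are paths and cycles.  Choosing pairs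
    greedily, a path end whenever there is one and an arbitrary pair when only
    cycles remain, is optimal.

    The RAM program is written in a small language with counting loops and
    unbounded arrays interleaved in memory.  Since the input occupies all the low
    cells, the program first copies it above an address that exceeds the input
    length, and at the end it moves the answer back down. *)

(** * Greedy selection of pairs *)

(** The order of the greedy choices matters: on a path of three pairs the middle one blocks both
    others. A choice is safe when deleting the chosen pair together with everything linked to it
    lowers the best remaining size by at most one pair. At a path end this is a plain swap, because
    only one usable pair can conflict. On a cycle both neighbours of the chosen pair may lie in the
    optimum, and a swap would trade two pairs for one; the optimum then has to be shifted along the
    opened cycle, which is what [path_exchange] does. A pair wins two blue features at the price of
    one red, so each of its exemplars earns one half. To stay within natural numbers, the margin
    inequalities are doubled and a selection is measured by its exemplars instead of its pairs. A
    missing partner is represented by an extra empty exemplar of index [m], whose table entries are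
    set so that neither the tests nor an idle round need a special case. *)

Section Greedy.
Variables (E : finType) (p q : E -> E).
Implicit Types (X Y Z : {set E}) (c j k : E).

(** Values of [p] and [q] outside [X] stand for missing or discarded partners. The involution law is
    demanded only where the value lies in [X], which makes the condition pass to subsets. *)
Definition partnered X : Prop :=
  forall j, j \in X ->
  [/\ p j != j, q j != j, p j \in X -> p (p j) = j & q j \in X -> q (q j) = j].

Definition feasible X Y : Prop :=
  forall j, j \in Y -> [/\ j \in X, p j \in Y & q j \notin Y].

(** The case [p j = q j] is a pair with the same red and the same blue feature: it conflicts with
    itself and would gain nothing. *)
Definition good X j : bool := [&& j \in X, p j \in X & p j != q j].

Lemma partneredS X X' : X' \subset X -> partnered X -> partnered X'.
Proof.
move=> /subsetP s h j /s/h[? ? hp hq]; split=> //.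
- by move/s/hp.
- by move/s/hq.
Qed.

Lemma feasible_good X Y j : feasible X Y -> j \in Y -> good X j.
Proof.
move=> f jY; have [jX pY qY] := f _ jY; have [pX _ _] := f _ pY.
by rewrite /good jX pX; apply: contraNneq qY => <-.
Qed.

Lemma feasible_not_good X Y : feasible X Y -> (forall j, ~~ good X j) -> Y = set0.
Proof.
move=> f h; apply/setP=> j; rewrite inE; apply/negP=> jY.
by have := h j; rewrite (feasible_good f jY).
Qed.

Lemma feasible_sub X X' Y :
  Y \subset X' -> feasible X Y -> feasible X' Y.
Proof. by move=> /subsetP s f j jY; have [_ ? ?] := f _ jY; split=> //; apply: s. Qed.

Lemma feasibleW X X' Y : X \subset X' -> feasible X Y -> feasible X' Y.
Proof. by move=> /subsetP s f j jY; have [/s ? ? ?] := f _ jY. Qed.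

Lemma feasible_in X Y j : feasible X Y -> j \in Y -> j \in X.
Proof. by move=> f /f[]. Qed.

Lemma feasible_p X Y j : partnered X -> feasible X Y -> j \in X -> p j \in X ->
  (p j \in Y) = (j \in Y).
Proof.
move=> h f jX pX; apply/idP/idP => [/f[_ + _]|/f[]//].
by have [_ _ -> //] := h _ jX.
Qed.

Lemma feasibleD_pair X Y j : partnered X -> feasible X Y -> j \in X -> p j \in X ->
  feasible X (Y :\: [set j; p j]).
Proof.
move=> h f jX pX k; rewrite !inE negb_or => /andP[/andP[kj kp] kY].
have [kX pY qY] := f _ kY; split=> //; last by rewrite (negPf qY) andbF.
rewrite pY andbT; apply/norP; split.
  apply: contraNneq kp => e; have [_ _ + _] := h _ kX.
  by rewrite e => /(_ jX) <-.
apply: contraNneq kj => e.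
have [_ _ + _] := h _ kX; have [_ _ + _] := h _ jX.
by rewrite e => /(_ pX) -> /(_ pX) ->.
Qed.

Lemma card_setD2 (A : {set E}) j k : #|A| <= #|A :\: [set j; k]| + 2.
Proof.
rewrite -(cardsID [set j; k] A) addnC leq_add2l.
by rewrite (leq_trans (subset_leq_card (subsetIr _ _))) // cards2; case: eqP.
Qed.

(* [u] and [v] are the two ends of a path component: every other element keeps
   its [q]-neighbour.  Induction peels the two edges nearest to [u]. *)
Lemma path_exchange N Z Y u v : #|Z| <= N -> partnered Z ->
  u \in Z -> v \in Z -> u != v -> q u \notin Z -> q v \notin Z ->
  (forall z, z \in Z -> p z \in Z) ->
  (forall z, z \in Z -> z != u -> z != v -> q z \in Z) ->
  feasible Z Y ->
  exists2 Y', feasible (Z :\: [set u; v]) Y' & #|Y| <= #|Y'| + 2.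
Proof.
elim: N Z Y u => [|N IH] Z Y u.
  by rewrite leqn0 cards_eq0 => /eqP ->; rewrite inE.
move=> cZ h uZ vZ uv quZ qvZ pZ qZ fY.
have [pu _ ppu _] := h _ uZ; set w := p u in pu ppu.
have wZ : w \in Z by apply: pZ.
have pw : p w = u by apply: ppu.
(* The path consists of a single pair. *)
have [ewv|wv] := eqVneq w v.
  exists (Y :\: [set u; v]); last exact: card_setD2.
  rewrite -ewv; apply: feasible_sub (feasibleD_pair h fY uZ wZ).
  by apply: setSD; apply/subsetP=> j /(feasible_in fY).
have xZ := qZ _ wZ pu wv; set x := q w in xZ.
have [_ xw _ /(_ xZ) qx] := h _ wZ; rewrite -/x in xw qx.
have [px _ /(_ (pZ _ xZ)) ppx _] := h _ xZ; set y := p x in px ppx.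
have yZ : y \in Z by apply: pZ.
have xu : x != u by apply: contraNneq quZ => <-; rewrite qx.
have xv : x != v by apply: contraNneq qvZ => <-; rewrite qx.
have yu : y != u by apply: contraNneq xw => e; rewrite -ppx e.
have yw : y != w by apply: contraNneq xu => e; rewrite -ppx e pw.
(* The two pairs nearest to [u] are cut off. They are linked by [q w = x], so [Y] contains at most
   one of them and [Y2] is short by at most two elements. *)
pose Z2 := Z :\: [set u; w] :\: [set x; y].
pose Y2 := Y :\: [set u; w] :\: [set x; y].
have sZ2 : Z2 \subset Z by rewrite /Z2 !subDset !setUA subsetUr.
have inZ2 k : k \in Z2 = [&& k != u, k != w, k != x, k != y & k \in Z].
  by rewrite !inE !negb_or -!andbA; do !case: (k == _) => //=.
have fY2 : feasible Z2 Y2.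
  apply: (@feasible_sub Z).
    by apply: setSD; apply: setSD; apply/subsetP=> j /(feasible_in fY).
  by apply: feasibleD_pair => //; apply: feasibleD_pair.
have cY2 : #|Y| <= #|Y2| + 2.
  have [uY|uY] := boolP (u \in Y).
    have xY : x \notin Y by have [_ /fY[]] := fY _ uY.
    have yY : y \notin Y by rewrite /y (feasible_p h fY) // pZ.
    have -> : Y2 = Y :\: [set u; w].
      apply/setP=> k; rewrite !inE !negb_or; case: eqP => [->|] /=.
        by rewrite (negPf xY) andbF.
      by case: eqP => [->|//]; rewrite (negPf yY) andbF.
    exact: card_setD2.
  have wY : w \notin Y by rewrite /w (feasible_p h fY).
  have -> : Y2 = Y :\: [set x; y].
    apply/setP=> k; rewrite !inE !negb_or; congr (_ && _).
    case: eqP => [->|_] /=; first by rewrite (negPf uY).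
    by case: eqP => [->|//]; rewrite (negPf wY).
  exact: card_setD2.
(* The path has just these two pairs, and [Y2] already avoids both. *)
have [eyv|yv] := eqVneq y v.
  exists Y2 => //; apply: feasibleW fY2; apply/subsetP=> k.
  by rewrite inZ2 -eyv !inE negb_or => /and5P[-> _ _ -> ->].
have zZ := qZ _ yZ yu yv; set z := q y in zZ.
have [_ zy _ /(_ zZ) qz] := h _ yZ; rewrite -/z in zy qz.
have zu : z != u by apply: contraNneq quZ => <-; rewrite qz.
have zv : z != v by apply: contraNneq qvZ => <-; rewrite qz.
have zw : z != w by apply: contraNneq px => e; rewrite -/y -qz e.
have zx : z != x by apply: contraNneq yw => e; rewrite -qz e qx.
have zZ2 : z \in Z2 by rewrite inZ2 zu zw zx zy.
have vZ2 : v \in Z2 by rewrite inZ2 vZ ![v == _]eq_sym uv wv xv yv.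
have [] := IH Z2 Y2 z _ (partneredS sZ2 h) zZ2 vZ2 zv _ _ _ _ fY2.
- rewrite -ltnS; apply: leq_trans cZ; apply: proper_card.
  by rewrite properE sZ2; apply/subsetPn; exists u; rewrite // inZ2 eqxx.
- by rewrite qz inZ2 eqxx !andbF.
- by rewrite inZ2 (negPf qvZ) !andbF.
- move=> k; rewrite !inZ2 => /and5P[ku kw kx ky kZ].
  have [_ _ /(_ (pZ _ kZ)) ppk _] := h _ kZ; rewrite pZ // andbT.
  apply/and4P; split.
  + by apply: contraNneq kw => e; rewrite -ppk e.
  + by apply: contraNneq ku => e; rewrite -ppk e pw.
  + by apply: contraNneq ky => e; rewrite -ppk e.
  + by apply: contraNneq kx => e; rewrite -ppk e ppx.
- move=> k; rewrite !inZ2 => /and5P[ku kw kx ky kZ] kz kv.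
  have qk := qZ _ kZ ku kv; have [_ _ _ /(_ qk) qqk] := h _ kZ.
  rewrite qk andbT; apply/and4P; split.
  + by apply: contraNneq quZ => e; rewrite -e qqk.
  + by apply: contraNneq kx => e; rewrite -qqk e.
  + by apply: contraNneq kw => e; rewrite -qqk e qx.
  + by apply: contraNneq kz => e; rewrite -qqk e.
move=> Y3 fY3 cY3.
have inY3 k : k \in Y3 -> [&& k != z, k != v, k != x, k != y, k != w, k != u & k \in Z].
  move/(feasible_in fY3); rewrite in_setD inZ2 !inE negb_or.
  by case/and3P=> /andP[-> ->] -> /and4P[-> -> -> ->].
have xY3 : x \notin Y3 by apply/negP=> /inY3; rewrite eqxx !andbF.
have yY3 : y \notin Y3 by apply/negP=> /inY3; rewrite eqxx !andbF.
(* Putting [x] and [y] back repays the two elements lost in [Y2]: their links lead only to [w],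
   which was cut off, and to [z], which [Y3] avoids as an end of the shorter path. *)
exists (x |: (y |: Y3)); last first.
  by rewrite !cardsU1 !inE negb_or eq_sym px xY3 yY3 /=; apply: leq_trans cY2 _;
     rewrite leq_add2r (leq_trans cY3) // addn2.
move=> k; rewrite !inE => /or3P[/eqP->|/eqP->|kY3].
- rewrite (negPf xu) (negPf xv) xZ -/y eqxx orbT qx; split=> //.
  rewrite (eq_sym w x) (negPf xw) (eq_sym w y) (negPf yw) /=.
  by apply/negP=> /inY3; rewrite eqxx !andbF.
- rewrite (negPf yu) (negPf yv) yZ ppx eqxx; split=> //.
  rewrite -/z (negPf zx) (negPf zy) /=.
  by apply/negP=> /inY3; rewrite eqxx.
- have /and5P[kz kv kx ky /and3P[kw ku kZ]] := inY3 _ kY3.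
  have [_ pY3 qY3] := fY3 _ kY3; rewrite (negPf ku) (negPf kv) kZ pY3 !orbT; split=> //.
  have qk := qZ _ kZ ku kv; have [_ _ _ /(_ qk) qqk] := h _ kZ.
  rewrite (negPf qY3) orbF; apply/norP; split.
    by apply: contraNneq kw => e; rewrite -qqk e qx.
  by apply: contraNneq kz => e; rewrite -qqk e.
Qed.

(** The red partners of [q c] and [q (p c)] may stay in the set: deprived of their own partners,
    they are no longer good. *)
Definition remaining X c : {set E} := X :\: [set c; p c] :\: [set q c; q (p c)].

Lemma in_remaining X c k : (k \in remaining X c) =
  [&& k != c, k != p c, k != q c, k != q (p c) & k \in X].
Proof. by rewrite !inE !negb_or -!andbA; do !case: (k == _) => //=. Qed.

Lemma remaining_sub X c : remaining X c \subset X.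
Proof. by rewrite /remaining !subDset !setUA subsetUr. Qed.

(** No feasible set contains [q c], so the pair of [c] can conflict only through [q (p c)]. If that
    neighbour is chosen, its pair is given up; otherwise it is enough to drop the pair of [c]
    itself. *)
Lemma leaf_exchange X Y c : partnered X -> feasible X Y -> good X c ->
  ~~ good X (q c) ->
  exists2 Y', feasible (remaining X c) Y' & #|Y| <= #|Y'| + 2.
Proof.
move=> h fY /and3P[cX pX pq] ng.
have qY : q c \notin Y by apply: contra ng; exact: feasible_good.
set d := q (p c).
have [dY|dY] := boolP (d \in Y); last first.
  exists (Y :\: [set c; p c]); last exact: card_setD2.
  have f := feasibleD_pair h fY cX pX.
  apply: feasible_sub f; apply/subsetP=> k; rewrite in_remaining !inE negb_or.
  case/andP=> /andP[-> ->] kY; rewrite (feasible_in fY kY) /= andbT.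
  by apply/andP; split; [apply: contraNneq qY => <-|apply: contraNneq dY => e;
    rewrite /d -e].
have [dX pdY _] := fY _ dY; have pdX := feasible_in fY pdY.
exists (Y :\: [set d; p d]); last exact: card_setD2.
have pcY : p c \notin Y by apply: contraL dY => /fY[].
have cY : c \notin Y by apply: contra pcY => /fY[].
have f := feasibleD_pair h fY dX pdX.
apply: feasible_sub f; apply/subsetP=> k; rewrite in_remaining !inE negb_or.
case/andP=> /andP[kd kpd] kY; rewrite kd (feasible_in fY kY) /= andbT.
by apply/and3P; split; [apply: contraNneq cY => <-|apply: contraNneq pcY => <-|
  apply: contraNneq qY => <-].
Qed.

(** Without path ends the good elements form closed cycles. If [c] is not in [Y], deleting its pair
    opens its cycle into a path with ends [q c] and [q (p c)], and [path_exchange] vacates both ends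
    for the price of one pair. *)
Lemma cycle_exchange X Y c : partnered X -> feasible X Y -> good X c ->
  (forall j, good X j -> good X (q j)) ->
  exists2 Y', feasible (remaining X c) Y' & #|Y| <= #|Y'| + 2.
Proof.
move=> h fY gc gq; have /and3P[cX pX pq] := gc.
have [cp _ /(_ pX) ppc _] := h _ cX.
have gX j : good X j -> j \in X by case/and3P.
have gp j : good X j -> good X (p j).
  move=> gj; have /and3P[jX pjX pqj] := gj; rewrite /good pjX.
  have [_ _ /(_ pjX) -> /(_ (gX _ (gq _ gj))) qqj] := h _ jX; rewrite jX /=.
  have [qpj|//] := eqVneq j (q (p j)).
  have [_ _ _] := h _ pjX; rewrite -qpj => /(_ jX) e.
  by move: pqj; rewrite e eqxx.
have qq j : good X j -> q (q j) = j.
  by move=> gj; have [_ _ _ ->//] := h _ (gX _ gj); apply/gX/gq.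
have qpc : q (p c) != c by apply: contraNneq pq => e; rewrite -{2}e qq ?gp.
have [cY|cY] := boolP (c \in Y).
  have [_ pY qY] := fY _ cY; have [_ _ qpY] := fY _ pY.
  exists (Y :\: [set c; p c]); last exact: card_setD2.
  apply: feasible_sub (feasibleD_pair h fY cX pX).
  apply/subsetP=> k; rewrite in_remaining !inE negb_or.
  case/andP=> /andP[-> ->] kY; rewrite (feasible_in fY kY) /= andbT.
  by apply/andP; split; [apply: contraNneq qY => <-|apply: contraNneq qpY => <-].
have pY : p c \notin Y by rewrite (feasible_p h fY).
pose Z := [set j | good X j] :\: [set c; p c].
have inZ k : k \in Z = [&& k != c, k != p c & good X k] by rewrite !inE negb_or andbA.
have sZ : Z \subset X by apply/subsetP=> k; rewrite inZ => /and3P[_ _ /gX].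
have [_ nqc _ _] := h _ cX; have [_ nqp _ _] := h _ pX.
have [] := @path_exchange #|Z| Z Y (q c) (q (p c)) (leqnn _) (partneredS sZ h).
- by rewrite inZ nqc eq_sym pq gq.
- by rewrite inZ qpc nqp gq ?gp.
- by apply: contraNneq cp => e; rewrite -(qq (p c)) ?gp // -e qq.
- by rewrite qq // inZ eqxx.
- by rewrite qq ?gp // inZ eqxx andbF.
- move=> z; rewrite !inZ => /and3P[zc zp gz]; rewrite gp // andbT.
  have /and3P[zX pzX _] := gz; have [_ _ /(_ pzX) ppz _] := h _ zX.
  apply/andP; split; first by apply: contraNneq zp => e; rewrite -ppz e.
  by apply: contraNneq zc => e; rewrite -ppz e ppc.
- move=> z; rewrite !inZ => /and3P[zc zp gz] zqc zqp; rewrite gq // andbT.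
  by apply/andP; split; [apply: contraNneq zqc => <-|apply: contraNneq zqp => <-];
    rewrite qq.
- apply: (feasible_sub _ fY); apply/subsetP=> k kY; rewrite inZ (feasible_good fY kY) andbT.
  by apply/andP; split; [apply: contraNneq cY => <-|apply: contraNneq pY => <-].
move=> Y' fY' cY'; exists Y' => //; apply: feasibleW fY'; apply/subsetP=> k.
by rewrite in_setD inZ in_remaining !inE negb_or => /andP[/andP[-> ->]] /and3P[-> -> /gX].
Qed.

(** The third clause lets later pairs join [Y] without conflict. The fourth is the optimality
    certificate: once [X] has no good element, [Z'] is empty and [Y] is maximum. *)
Definition greedy_inv X0 X Y : Prop :=
  [/\ X \subset X0, feasible X0 Y, (forall j, j \in Y -> q j \notin X) &
      forall Z, feasible X0 Z -> exists2 Z', feasible X Z' & #|Z| <= #|Y| + #|Z'|].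

Lemma greedy_inv0 X0 : greedy_inv X0 X0 set0.
Proof. by split=> // [j|j|Z f]; rewrite ?inE //; exists Z; rewrite // cards0. Qed.

(** Each exchange lemma loses at most two elements, exactly the size of the pair that joins [Y], so
    the certificate survives. *)
Lemma greedy_step X0 X Y c : partnered X0 -> greedy_inv X0 X Y ->
  good X c -> (~~ good X (q c) \/ forall j, good X j -> good X (q j)) ->
  [disjoint Y & X] ->
  greedy_inv X0 (remaining X c) (Y :|: [set c; p c]) /\
  [disjoint Y :|: [set c; p c] & remaining X c].
Proof.
move=> h0 [sX fY qY opt] gc alt dYX; have h := partneredS sX h0.
have /and3P[cX pX pq] := gc.
have [cp nq /(_ pX) ppc _] := h _ cX; have [_ nqp _ _] := h _ pX.
have YX k : k \in Y -> k \in X -> False.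
  by move=> kY kX; move/pred0P: dYX => /(_ k) /=; rewrite kY kX.
have qnY j : j \in X -> q j \notin Y.
  move=> jX; apply/negP=> qjY; have := qY _ qjY.
  have [_ _ _ ->] := h0 _ (subsetP sX _ jX); first by rewrite jX.
  exact: feasible_in qjY.
have qpc : q (p c) != c.
  apply: contraNneq pq => e; have [_ _ _] := h _ pX.
  by rewrite e => /(_ cX) ->.
split; last first.
  apply/pred0P=> k /=; rewrite in_remaining !inE.
  apply/negP=> /andP[/or3P[kY|/eqP->|/eqP->]]; rewrite ?eqxx ?andbF //.
  by case/and5P=> _ _ _ _; exact: YX.
split.
- exact: subset_trans (remaining_sub _ _) sX.
- move=> j; rewrite !inE => /or3P[jY|/eqP->|/eqP->].
  + have [jX pY qjY] := fY _ jY; rewrite pY; split=> //; rewrite (negPf qjY) /=.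
    by apply/norP; split; apply: contraNneq (qY _ jY) => ->.
  + split; [exact: subsetP cX|by rewrite eqxx !orbT|].
    by rewrite (negPf (qnY _ cX)) (negPf nq) eq_sym.
  + split; [exact: subsetP pX|by rewrite ppc eqxx !orbT|].
    by rewrite (negPf (qnY _ pX)) (negPf qpc).
- move=> j; rewrite in_remaining !inE => /or3P[jY|/eqP->|/eqP->]; rewrite ?eqxx ?andbF //.
  by rewrite (negPf (qY _ jY)) !andbF.
- move=> Z /opt[Z' fZ' cZ].
  have [Z2 f2 c2] : exists2 Y', feasible (remaining X c) Y' & #|Z'| <= #|Y'| + 2.
    by case: alt => [?|?]; [exact: leaf_exchange|exact: cycle_exchange].
  exists Z2 => //; apply: leq_trans cZ _.
  rewrite cardsU cards2 eq_sym cp /=.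
  have -> : Y :&: [set c; p c] = set0.
    apply/setP=> k; rewrite !inE; apply/negP=> /andP[kY /orP[]/eqP e];
    by apply: (YX k); rewrite ?e // -e.
  by rewrite cards0 subn0 -addnA leq_add2l addnC.
Qed.

End Greedy.

(** * Margins and feasible sets of pairs *)

Section Exemplars.
Variables (F E : finType) (T : {set F}) (S : E -> {set F}).
Hypothesis occ2 : forall i, #|[set j | i \in S j]| <= 2.
Hypothesis wt2 : forall j, #|S j| <= 2.
Implicit Types (b : bool) (i : F) (j k : E) (A Y Z : {set E}).

(* The colour [true] is blue, [false] is red. *)
Definition feature b j i : bool := ((i \in T) == b) && (i \in S j).
Definition has_col b j : bool := [exists i, feature b j i].
Definition shares b j k : bool := [exists i, feature b j i && feature b k i].

(** A mixed exemplar outside [live] has its blue feature already supplied by an exemplar without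
    red, so taking it could only add red. *)
Definition live : {set E} :=
  [set j | [&& has_col true j, has_col false j &
     [forall k, (k != j) ==> shares true j k ==> has_col false k]]].

(** To keep [f] total, the absence of a partner is encoded by some value outside [live]. *)
Definition partner_map b (f : E -> E) : Prop :=
  forall j, j \in live -> f j != j /\
  (shares b j (f j) \/ (f j \notin live /\ forall k, k != j -> ~~ shares b j k)).

Lemma live_has b j : j \in live -> has_col b j.
Proof. by rewrite inE => /and3P[]; case: b. Qed.

(** A feature of the other colour leaves room for only one of colour [b] under weight 2. *)
Lemma mixed_uniq b j i i' : has_col (~~ b) j -> feature b j i -> feature b j i' -> i = i'.
Proof.
move=> /existsP[x /andP[xb xS]] /andP[ib iS] /andP[ib' iS'].
apply: contraTeq (wt2 j) => ii'; rewrite -ltnNge.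
have ne y : (y \in T) == b -> x != y.
  by move/eqP=> yb; apply: contraTneq xb => ->; rewrite yb; case: (b).
have c3 : #|x |: [set i; i']| = 3.
  by rewrite cardsU1 cards2 ii' !inE negb_or !ne.
rewrite -c3; apply: subset_leq_card.
by apply/subsetP=> y; rewrite !inE => /or3P[]/eqP->.
Qed.

Lemma live_uniq b j i i' : j \in live -> feature b j i -> feature b j i' -> i = i'.
Proof. by move=> jl; apply: mixed_uniq; apply: live_has. Qed.

Lemma occ_uniq i j k l : i \in S j -> i \in S k -> i \in S l -> k != j -> l != j -> k = l.
Proof.
move=> ij ik il kj lj; apply: contraTeq (occ2 i) => kl; rewrite -ltnNge.
have c3 : #|j |: [set k; l]| = 3.
  by rewrite cardsU1 cards2 kl !inE negb_or ![j == _]eq_sym kj lj.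
rewrite -c3; apply: subset_leq_card.
by apply/subsetP=> y; rewrite !inE => /or3P[]/eqP->.
Qed.

Lemma shares_uniq b j k l : has_col (~~ b) j -> k != j -> l != j ->
  shares b j k -> shares b j l -> k = l.
Proof.
move=> jl kj lj /existsP[i /andP[ij ik]] /existsP[i' /andP[ij' il]].
have e := mixed_uniq jl ij' ij; rewrite e in il.
case/andP: ij => _ ij; case/andP: ik => _ ik; case/andP: il => _ il.
exact: occ_uniq ij ik il kj lj.
Qed.

Lemma sharesC b j k : shares b j k = shares b k j.
Proof. by apply: eq_existsb => i; rewrite andbC. Qed.

Lemma partner_uniq b f j k : partner_map b f -> j \in live -> k != j ->
  shares b j k -> f j = k.
Proof.
move=> pf jl kj sk; have [fj [sf|[_ no]]] := pf _ jl.
  exact: (shares_uniq (live_has _ jl) fj kj sf sk).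
by have := no _ kj; rewrite sk.
Qed.

Lemma partner_shares b f j : partner_map b f -> j \in live -> f j \in live ->
  shares b j (f j).
Proof. by move=> pf jl fl; have [_ [//|[]]] := pf _ jl; rewrite fl. Qed.

Lemma partner_invol b f j : partner_map b f -> j \in live -> f j \in live ->
  f (f j) = j.
Proof.
move=> pf jl fl; apply: (partner_uniq pf fl).
  by have [] := pf _ jl; rewrite eq_sym.
by rewrite sharesC partner_shares.
Qed.

Definition colset b Z : {set F} := [set i | [exists j in Z, feature b j i]].

(** A live exemplar has exactly one feature of colour [b], so its weight enters exactly one inner
    sum. The constant weight 1 counts exemplars; the upper bound on margins needs a non-constant
    one. *)
Lemma colset_double_count b Z (w : E -> nat) : Z \subset live ->
  \sum_(i in colset b Z) \sum_(j in Z | feature b j i) w j = \sum_(j in Z) w j.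
Proof.
move=> /subsetP sZ.
rewrite (exchange_big_dep (mem Z)) /=; last by move=> i j _ /andP[].
apply: eq_bigr => j jZ.
have /existsP[i ij] := live_has b (sZ _ jZ).
rewrite (bigD1 i) /=; last by rewrite jZ ij !andbT inE; apply/existsP; exists j; rewrite jZ.
rewrite big1 ?addn0 // => k /andP[/and3P[_ _ kj] /eqP[]].
exact: live_uniq (sZ _ jZ) kj ij.
Qed.

(** * Upper and lower bounds on the margin *)

Section Optimality.
Variables (p q : E -> E).
Hypotheses (pP : partner_map false p) (qP : partner_map true q).

Lemma partnered_live : partnered p q live.
Proof.
move=> j jl; have [? _] := pP jl; have [? _] := qP jl.
by split=> //; [apply: partner_invol pP jl|apply: partner_invol qP jl].
Qed.

Definition covered A : {set F} := \bigcup_(j in A) S j.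
Definition pure : {set E} := [set j | ~~ has_col false j].

Lemma live_blue_uncovered j i : j \in live -> feature true j i -> i \notin covered pure.
Proof.
move=> jl ij; apply/bigcupP=> -[k]; rewrite inE => kp ik.
move: (jl); rewrite inE => /and3P[_ _ /forallP/(_ k)].
have -> : k != j by apply: contraNneq kp => ->; apply: live_has.
have -> : shares true j k.
  by apply/existsP; exists i; rewrite ij /feature ik; case/andP: ij => ->.
by rewrite (negPf kp).
Qed.

Lemma col_uncovered_live j i : i \in T :\: covered pure -> i \in S j -> j \in live.
Proof.
rewrite inE => /andP[ib iT] ij.
have mx k : i \in S k -> has_col false k.
  by move=> ik; apply: contraNT ib => kp; apply/bigcupP; exists k; rewrite ?inE.
rewrite inE mx //=; apply/andP; split.
  by apply/existsP; exists i; rewrite /feature iT ij.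
apply/forallP=> k; apply/implyP=> kj; apply/implyP=> /existsP[i' /andP[ij' ik]].
apply: (mx k); suff <- : i' = i by case/andP: ik.
by apply: (@mixed_uniq true j i' i (mx _ ij) ij'); rewrite /feature iT ij.
Qed.

(** Each blue feature of [A] missed by the pure exemplars gets one representative in [A].
    Representatives are live, hence cost one red feature each, and a red feature is shared by two of
    them only if they are red partners. [Y] collects the representatives whose red partner is a
    representative too. *)
Lemma margin_upper A : exists2 Y, feasible p q live Y &
  (#|covered A :&: T|).*2 <= (#|covered A :\: T|).*2 + (#|covered pure|).*2 + #|Y|.
Proof.
pose U := (covered A :&: T) :\: covered pure.
pose rep i := [pick j in A | feature true j i].
pose Z := [set j | [exists i in U, rep i == Some j]].
have inZ j : j \in Z -> exists i, [/\ i \in U, rep i = Some j, j \in A & feature true j i].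
  rewrite inE => /existsP[i /andP[iU /eqP e]]; exists i; split=> //.
    by move: e; rewrite /rep; case: pickP => // k /andP[kA _] [<-].
  by move: e; rewrite /rep; case: pickP => // k /andP[_ kc] [<-].
have Zlive : Z \subset live.
  apply/subsetP=> j /inZ[i [iU _ _ /andP[_ ij]]].
  case/setDP: iU => /setIP[_ iT] ib.
  by apply: (@col_uncovered_live j i) => //; rewrite inE ib.
have UZ : #|U| <= #|Z|.
  rewrite -[#|Z|]sum1_card -(colset_double_count true _ Zlive).
  have sU : U \subset colset true Z.
    apply/subsetP=> i iU; rewrite inE.
    have [j e] : exists j, rep i = Some j.
      move: (iU); rewrite !inE => /and3P[_ /bigcupP[j jA ij] iT].
      rewrite /rep; case: pickP => [k _|/(_ j)]; first by exists k.
      by rewrite jA /feature iT ij.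
    apply/existsP; exists j; apply/andP; split.
      by rewrite inE; apply/existsP; exists i; rewrite iU e eqxx.
    by move: e; rewrite /rep; case: pickP => // k /andP[_ ?] [<-].
  apply: leq_trans (subset_leq_card sU) _; rewrite -sum1_card; apply: leq_sum => i.
  rewrite inE => /existsP[j /andP[jZ ij]]; rewrite (bigD1 j) //=.
  by rewrite jZ.
pose Y := [set j in Z | p j \in Z].
have inY j : (j \in Y) = (j \in Z) && (p j \in Z) by rewrite in_set.
(* Two representatives with a common blue feature would represent the same feature, hence
   coincide. *)
have ZY j : j \in Z -> q j \notin Z.
  move=> jZ; apply/negP=> qZ; have jl := subsetP Zlive _ jZ; have ql := subsetP Zlive _ qZ.
  have [i [_ ri _ ij]] := inZ _ jZ; have [i' [_ ri' _ iq]] := inZ _ qZ.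
  have [+ _] := qP jl; move/eqP; apply.
  have /existsP[x /andP[xj xq]] := partner_shares qP jl ql.
  have ei := live_uniq jl xj ij; have ei' := live_uniq ql xq iq.
  by move: ri ri'; rewrite -ei -ei' => -> [].
have fY : feasible p q live Y.
  move=> j; rewrite !inY => /andP[jZ pZ].
  have jl := subsetP Zlive _ jZ; have pl := subsetP Zlive _ pZ.
  by rewrite jl pZ (partner_invol pP jl pl) jZ (negPf (ZY _ jZ)).
exists Y => //.
have Ub : #|covered A :&: T| <= #|covered pure| + #|U|.
  rewrite -(cardsID (covered pure)) leq_add2r.
  exact/subset_leq_card/subsetIr.
have Rd : #|colset false Z| <= #|covered A :\: T|.
  apply: subset_leq_card; apply/subsetP=> i; rewrite !inE.
  case/existsP=> j /andP[/inZ[_ [_ _ jA _]] /andP[/eqP-> ij]] /=.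
  by apply/bigcupP; exists j.
(* With weight 1 for paired and 2 for single representatives, every red feature receives at most 2,
   while the total is [2 * #|Z| - #|Y|]. *)
pose w j := if j \in Y then 1 else 2.
have W : (#|Z|).*2 <= (#|colset false Z|).*2 + #|Y|.
  have -> : (#|Z|).*2 = \sum_(j in Z) w j + #|Y|.
    have sY : Y \subset Z by apply/subsetP=> j; rewrite inY => /andP[].
    rewrite (big_setID Y) /= (setIidPr sY) -(cardsID Y Z) (setIidPr sY).
    have -> : \sum_(j in Y) w j = #|Y|.
      by rewrite -sum1_card; apply: eq_bigr => j jY; rewrite /w jY.
    have -> : \sum_(j in Z :\: Y) w j = #|Z :\: Y| * 2.
      rewrite -sum_nat_const; apply: eq_bigr => j /setDP[_ jY].
      by rewrite /w (negPf jY).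
    by rewrite muln2 -addnn; move: #|Y| #|Z :\: Y| => *; lia.
  rewrite leq_add2r -(colset_double_count false _ Zlive).
  rewrite -muln2 -sum_nat_const; apply: leq_sum => i _.
  have [/existsP[j /and3P[jZ ij jY]]|none] :=
    boolP [exists j, [&& j \in Z, feature false j i & j \notin Y]].
    rewrite (bigD1 j) ?jZ //= /w (negPf jY) big1 // => k /andP[/andP[kZ ik] kj].
    case/negP: jY; rewrite inY jZ.
    suff -> : p j = k by [].
    apply: (partner_uniq pP (subsetP Zlive _ jZ) kj).
    by apply/existsP; exists i; rewrite ij.
  rewrite (eq_bigr (fun _ => 1)); last first.
    move=> j /andP[jZ ij]; move/existsPn/(_ j): none.
    by rewrite jZ ij /= negbK /w => ->.
  rewrite sum1_card; apply: leq_trans (occ2 i); apply: subset_leq_card.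
  by apply/subsetP=> j; rewrite !inE => /and3P[_ _].
lia.
Qed.

(** The blue features of [Y] are pairwise distinct because no two members are linked by [q], and
    live exemplars keep them apart from the pure ones. Each red feature of [Y] lies in two members,
    so there are at most half as many. *)
Lemma margin_lower Y : feasible p q live Y ->
  (#|covered (pure :|: Y) :\: T|).*2 + (#|covered pure|).*2 + #|Y|
    <= (#|covered (pure :|: Y) :&: T|).*2.
Proof.
move=> fY.
have Yl : Y \subset live by apply/subsetP=> j /fY[].
have blue : #|covered pure| + #|Y| <= #|covered (pure :|: Y) :&: T|.
  have cY : #|Y| <= #|colset true Y|.
    rewrite -[#|Y|]sum1_card -(colset_double_count true _ Yl) -sum1_card.
    apply: leq_sum => i; rewrite inE => /existsP[j /andP[jY ij]].
    rewrite (bigD1 j) ?jY //= big1 // => k /andP[/andP[kY ik] kj].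
    have [jl _] := fY _ jY; case/negP.
    suff -> : q j = k by [].
    by apply: (partner_uniq qP jl kj); apply/existsP; exists i; rewrite ij.
  apply: leq_trans (_ : #|covered pure| + #|colset true Y| <= _).
    by rewrite leq_add2l.
  have d0 : covered pure :&: colset true Y = set0.
    apply/setP=> i; rewrite !inE; apply/negP=> /andP[ip /existsP[j /andP[jY ij]]].
    by have := live_blue_uncovered (subsetP Yl _ jY) ij; rewrite ip.
  rewrite -cardsUI d0 cards0 addn0; apply: subset_leq_card.
  apply/subsetP=> i; rewrite !inE => /orP[/bigcupP[j jp ij]|/existsP[j /andP[jY]]].
    apply/andP; split; first by apply/bigcupP; exists j; rewrite // inE jp.
    by move: jp; rewrite inE => /existsPn/(_ i); rewrite /feature ij; case: (i \in T).
  case/andP=> /eqP-> ij; rewrite andbT.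
  by apply/bigcupP; exists j; rewrite // inE jY orbT.
have red : (#|covered (pure :|: Y) :\: T|).*2 <= #|Y|.
  apply: leq_trans (_ : (#|colset false Y|).*2 <= _).
    rewrite leq_double; apply: subset_leq_card; apply/subsetP=> i.
    rewrite inE => /andP[iT /bigcupP[j jA ij]].
    have cj : feature false j i by rewrite /feature (negPf iT) ij.
    rewrite inE; apply/existsP; exists j; rewrite cj andbT.
    move: jA; rewrite inE => /orP[|//]; rewrite inE => /existsPn/(_ i).
    by rewrite cj.
  rewrite -[#|Y|]sum1_card -(colset_double_count false _ Yl) -muln2 -sum_nat_const.
  apply: leq_sum => i; rewrite inE => /existsP[j /andP[jY ij]].
  have [jl pY _] := fY _ jY; have pl := subsetP Yl _ pY; have [pj _] := pP jl.
  rewrite (bigD1 j) ?jY //= (bigD1 (p j)) //= pY pj andbT.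
  have /existsP[x /andP[xj xp]] := partner_shares pP jl pl.
  by rewrite -(live_uniq jl xj ij).
lia.
Qed.

Lemma feasible_max_margin Y A : feasible p q live Y ->
  (forall Z, feasible p q live Z -> #|Z| <= #|Y|) ->
  #|covered A :&: T| + #|covered (pure :|: Y) :\: T| <=
  #|covered (pure :|: Y) :&: T| + #|covered A :\: T|.
Proof.
move=> fY mY; have [Z /mY cZ uZ] := margin_upper A.
have := margin_lower fY; lia.
Qed.

End Optimality.
End Exemplars.

(** * Structured RAM programs *)

Inductive rc : Type :=
| RBlock of seq instr
| RSeq of rc & rc
| RIf of nat & rc & rc
| RWhile of nat & rc.

Definition basic (i : instr) : bool :=
  match i with IJz _ _ | IJmp _ => false | _ => true end.

Definition istep (M : memory) (i : instr) : memory :=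
  match i with
  | IConst r v => upd M r v
  | IAdd r a b => upd M r (M a + M b)
  | ISub r a b => upd M r (M a - M b)
  | ILoad r a => upd M r (M (M a))
  | IStore a r => upd M (M a) (M r)
  | _ => M
  end.

(** The number is the exact count of machine steps: a first branch pays for the test and for the
    jump over the second branch, a loop iteration for the test and the jump back. *)
Inductive exec : rc -> memory -> nat -> memory -> Prop :=
| ExBlock l M : all basic l -> exec (RBlock l) M (size l) (foldl istep M l)
| ExSeq c1 c2 M M1 M2 t1 t2 :
    exec c1 M t1 M1 -> exec c2 M1 t2 M2 -> exec (RSeq c1 c2) M (t1 + t2) M2
| ExIfT r c1 c2 M M1 t :
    M r != 0 -> exec c1 M t M1 -> exec (RIf r c1 c2) M t.+2 M1
| ExIfF r c1 c2 M M1 t :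
    M r = 0 -> exec c2 M t M1 -> exec (RIf r c1 c2) M t.+1 M1
| ExWhileF r c M : M r = 0 -> exec (RWhile r c) M 1 M
| ExWhileT r c M M1 M2 t1 t2 :
    M r != 0 -> exec c M t1 M1 -> exec (RWhile r c) M1 t2 M2 ->
    exec (RWhile r c) M (t1 + t2).+2 M2.

Fixpoint rsize (c : rc) : nat :=
  match c with
  | RBlock l => size l
  | RSeq c1 c2 => rsize c1 + rsize c2
  | RIf _ c1 c2 => (rsize c1 + rsize c2).+2
  | RWhile _ c => (rsize c).+2
  end.

Fixpoint assemble (pc : nat) (c : rc) : seq instr :=
  match c with
  | RBlock l => l
  | RSeq c1 c2 => assemble pc c1 ++ assemble (pc + rsize c1) c2
  | RIf r c1 c2 =>
      IJz r (pc + rsize c1).+2 :: assemble pc.+1 c1 ++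
      IJmp (pc + rsize c1 + rsize c2).+2 :: assemble (pc + rsize c1).+2 c2
  | RWhile r c =>
      IJz r (pc + rsize c).+2 :: assemble pc.+1 c ++ [:: IJmp pc]
  end.

Lemma size_assemble c pc : size (assemble pc c) = rsize c.
Proof.
elim: c pc => [l|c1 IH1 c2 IH2|r c1 IH1 c2 IH2|r c IH] pc //=.
- by rewrite size_cat IH1 IH2.
- by rewrite size_cat /= IH1 IH2 addnS.
- by rewrite size_cat /= IH addn1.
Qed.

Definition code_at (p : seq instr) (pc : nat) (l : seq instr) : Prop :=
  exists pre post, p = pre ++ l ++ post /\ size pre = pc.

Lemma code_at_cat p pc l1 l2 :
  code_at p pc (l1 ++ l2) -> code_at p pc l1 /\ code_at p (pc + size l1) l2.
Proof.
move=> [pre [post [-> <-]]]; split; first by exists pre, (l2 ++ post); rewrite !catA.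
by exists (pre ++ l1), post; rewrite !catA size_cat.
Qed.

Lemma code_at_cons p pc i l :
  code_at p pc (i :: l) -> code_at p pc [:: i] /\ code_at p pc.+1 l.
Proof. by move=> /(@code_at_cat p pc [:: i] l); rewrite addn1. Qed.

Lemma run_code p pc i f M :
  code_at p pc [:: i] ->
  run f.+1 p pc M =
    match i with
    | IJz r l => run f p (if M r == 0 then l else pc.+1) M
    | IJmp l => run f p l M
    | _ => run f p pc.+1 (istep M i)
    end.
Proof.
move=> [pre [post [-> <-]]] /=.
rewrite size_cat /= leqNgt addnS ltnS leq_addr /= /step nth_cat ltnn subnn /=.
by case: i.
Qed.

Lemma run_halted p pc f M : size p <= pc -> run f p pc M = Some M.
Proof. by case: f => [|f] /= ->. Qed.

Arguments run : simpl never.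

Lemma run_block p l : all basic l -> forall pc f M, code_at p pc l ->
  run (size l + f) p pc M = run f p (pc + size l) (foldl istep M l).
Proof.
elim: l => [|i l IH] /= => [_ pc f M _|/andP[bi bl] pc f M /code_at_cons[ci cl]].
  by rewrite addn0.
rewrite addSn (run_code _ _ ci) addnS -addSn -IH //.
by case: i bi {ci}.
Qed.

(** The spare fuel [f] is carried along so that runs of consecutive fragments chain by rewriting. *)
Lemma exec_run c M t M' : exec c M t M' -> forall p pc f,
  code_at p pc (assemble pc c) ->
  run (t + f) p pc M = run f p (pc + rsize c) M'.
Proof.
elim=> {c M t M'}.
- by move=> l M bl p pc f; exact: run_block.
- move=> c1 c2 M M1 M2 t1 t2 _ IH1 _ IH2 p pc f /code_at_cat[h1].
  by rewrite size_assemble => h2; rewrite -addnA IH1 // IH2 //= addnA.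
- move=> r c1 c2 M M1 t Mr _ IH p pc f /= /code_at_cons[h0 /code_at_cat[h1]].
  rewrite size_assemble => /code_at_cons[h2 h3].
  rewrite (run_code (t.+1 + f) M h0) (negPf Mr) addSnnS IH //.
  by rewrite (run_code _ _ h2) !addnS addnA.
- move=> r c1 c2 M M1 t Mr _ IH p pc f /= /code_at_cons[h0 /code_at_cat[h1]].
  rewrite size_assemble => /code_at_cons[h2 h3].
  rewrite (run_code (t + f) M h0) Mr eqxx IH; last by rewrite -[_.+2]/(pc.+1 + _).+1.
  by rewrite !addnS !addSn addnA.
- move=> r c M Mr p pc f /= /code_at_cons[h0 _].
  by rewrite add1n (run_code _ _ h0) Mr eqxx !addnS.
- move=> r c M M1 M2 t1 t2 Mr _ IH1 _ IH2 p pc f /= h.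
  have [h0 /code_at_cat[h1]] := code_at_cons h.
  rewrite size_assemble => h2.
  rewrite !addSn -addnS (run_code _ _ h0) (negPf Mr) addnS -addnA -addnS IH1 //.
  by rewrite (run_code _ _ h2) IH2.
Qed.

Lemma exec_program c M t M' fuel : exec c M t M' -> t <= fuel ->
  run fuel (assemble 0 c) 0 M = Some M'.
Proof.
move=> /exec_run h /subnKC <-; rewrite h; last first.
  by exists [::], [::]; rewrite cats0.
by rewrite run_halted ?size_assemble.
Qed.

(** * A language with counting loops and arrays *)

Inductive cmd : Type :=
| Skip
| Const of nat & nat
| Plus of nat & nat & nat
| Minus of nat & nat & nat
| Get of nat & nat & nat
| Put of nat & nat & nat
| Then of cmd & cmd
| Cond of nat & cmd & cmd
| For of nat & nat & cmd.

Record state := State { vs : nat -> nat; ar : nat -> nat -> nat }.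

Definition setv (s : state) (v x : nat) : state := State (upd (vs s) v x) (ar s).
Definition seta (s : state) (a i x : nat) : state :=
  State (vs s) (fun b => if b == a then upd (ar s a) i x else ar s b).

(** Loops run downwards, so that the counter itself is the zero test of the machine loop. *)
Fixpoint countdown (f : state -> state) (u k : nat) (s : state) : state :=
  if k is k'.+1 then countdown f u k' (f (setv s u k')) else s.

Fixpoint eval (c : cmd) (s : state) : state :=
  match c with
  | Skip => s
  | Const v k => setv s v k
  | Plus v a b => setv s v (vs s a + vs s b)
  | Minus v a b => setv s v (vs s a - vs s b)
  | Get v a i => setv s v (ar s a (vs s i))
  | Put a i v => seta s a (vs s i) (vs s v)
  | Then c1 c2 => eval c2 (eval c1 s)
  | Cond v c1 c2 => if vs s v != 0 then eval c1 s else eval c2 s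
  | For u b c => countdown (eval c) u (vs s b) (setv s u (vs s b))
  end.

(** [I k] is to be read as: the iterations for all counter values from [k] up are done. *)
Lemma for_ind (I : nat -> state -> Prop) u b c s :
  I (vs s b) (setv s u (vs s b)) ->
  (forall k s', k < vs s b -> I k.+1 s' -> I k (eval c (setv s' u k))) ->
  I 0 (eval (For u b c) s).
Proof.
move=> /= h0 hS.
have gen k s0 : k <= vs s b -> I k s0 -> I 0 (countdown (eval c) u k s0).
  elim: k s0 => [|k IH] s0 kN h //=.
  by apply: IH; [exact: ltnW|exact: hS].
exact: gen.
Qed.

Fixpoint modv (v : nat) (c : cmd) : bool :=
  match c with
  | Skip | Put _ _ _ => false
  | Const u _ | Plus u _ _ | Minus u _ _ | Get u _ _ => u == v
  | Then c1 c2 | Cond _ c1 c2 => modv v c1 || modv v c2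
  | For u _ c => (u == v) || modv v c
  end.

Fixpoint moda (a : nat) (c : cmd) : bool :=
  match c with
  | Put b _ _ => b == a
  | Then c1 c2 | Cond _ c1 c2 => moda a c1 || moda a c2
  | For u _ c => moda a c
  | _ => false
  end.

Lemma eval_vs c v s : ~~ modv v c -> vs (eval c s) v = vs s v.
Proof.
elim: c s => [|u k|u a b|u a b|u a i|a i u|c1 IH1 c2 IH2|u c1 IH1 c2 IH2|u b c IH] s //=;
  rewrite ?negb_or; try by rewrite /upd eq_sym => /negPf->.
- by case/andP=> ? ?; rewrite IH2 ?IH1.
- by case/andP=> ? ?; case: ifP => _; rewrite ?IH1 ?IH2.
- case/andP=> uv cv.
  have upv s' x : vs (setv s' u x) v = vs s' v by rewrite /= /upd eq_sym (negPf uv).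
  rewrite -[RHS](upv s (vs s b)); move: (vs s b) {2 3}(vs s b) => k x.
  elim: k (setv s u x) => //= k IHk s'.
  by rewrite IHk IH // upv.
Qed.

Lemma eval_ar c a s : ~~ moda a c -> ar (eval c s) a = ar s a.
Proof.
elim: c s => [|u k|u a' b|u a' b|u a' i|a' i u|c1 IH1 c2 IH2|u c1 IH1 c2 IH2|u b c IH] s //=;
  rewrite ?negb_or.
- by rewrite eq_sym => /negPf->.
- by case/andP=> ? ?; rewrite IH2 ?IH1.
- by case/andP=> ? ?; case: ifP => _; rewrite ?IH1 ?IH2.
- move=> ca; rewrite -[RHS]/(ar (setv s u (vs s b)) a); move: (vs s b) {2 3}(vs s b) => k x.
  elim: k (setv s u x) => //= k IHk s'.
  by rewrite IHk IH.
Qed.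

(* Machine registers 0 to 3 hold the constant 1, the base address and two
   temporaries; variable [v] lives in register [v + 4] and entry [i] of array
   [a] at address [base + 8 * i + a]. *)
Definition nvars := 20.
Definition reg (v : nat) := v + 4.

(** Without a multiplication instruction, the factor 8 is obtained by doubling three times. *)
Definition address (a i : nat) : seq instr :=
  [:: IAdd 2 (reg i) (reg i); IAdd 2 2 2; IAdd 2 2 2; IAdd 2 2 1;
      IConst 3 a; IAdd 2 2 3].

Fixpoint trans (c : cmd) : rc :=
  match c with
  | Skip => RBlock [::]
  | Const v k => RBlock [:: IConst (reg v) k]
  | Plus v a b => RBlock [:: IAdd (reg v) (reg a) (reg b)]
  | Minus v a b => RBlock [:: ISub (reg v) (reg a) (reg b)]
  | Get v a i => RBlock (rcons (address a i) (ILoad (reg v) 2))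
  | Put a i v => RBlock (rcons (address a i) (IStore 2 (reg v)))
  | Then c1 c2 => RSeq (trans c1) (trans c2)
  | Cond v c1 c2 => RIf (reg v) (trans c1) (trans c2)
  | For u b c =>
      (* There is no move instruction and no register known to be zero: a copy adds and then
         subtracts the constant 1 held in register 0. *)
      RSeq (RBlock [:: IAdd (reg u) (reg b) 0; ISub (reg u) (reg u) 0])
           (RWhile (reg u) (RSeq (RBlock [:: ISub (reg u) (reg u) 0]) (trans c)))
  end.

(** A loop body must not write its counter: [countdown] resets the counter before each iteration,
    whereas the machine merely decrements it. *)
Fixpoint wf (c : cmd) : bool :=
  match c with
  | Skip => true
  | Const v _ => v < nvars
  | Plus v a b | Minus v a b => [&& v < nvars, a < nvars & b < nvars]
  | Get v a i | Put a i v => [&& v < nvars, a < 8 & i < nvars]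
  | Then c1 c2 => wf c1 && wf c2
  | Cond v c1 c2 => [&& v < nvars, wf c1 & wf c2]
  | For u b c => [&& u < nvars, b < nvars, ~~ modv u c & wf c]
  end.

(* Bounds the running time when every loop bound is at most [B]. *)
Fixpoint cost (B : nat) (c : cmd) : nat :=
  match c with
  | Skip => 0
  | Const _ _ | Plus _ _ _ | Minus _ _ _ => 1
  | Get _ _ _ | Put _ _ _ => 7
  | Then c1 c2 => cost B c1 + cost B c2
  | Cond _ c1 c2 => (cost B c1 + cost B c2).+2
  | For _ _ c => B * (cost B c).+3 + 3
  end.

(** Every loop bound is a variable of [bs], and none of these is ever assigned, so a bound on their
    initial values controls all loops. *)
Fixpoint bounds_fixed (bs : seq nat) (c : cmd) : bool :=
  match c with
  | Then c1 c2 | Cond _ c1 c2 => bounds_fixed bs c1 && bounds_fixed bs c2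
  | For u b c => [&& b \in bs, u \notin bs & bounds_fixed bs c]
  | Const v _ | Plus v _ _ | Minus v _ _ | Get v _ _ => v \notin bs
  | _ => true
  end.

Definition represents (D : nat) (s : state) (M : memory) : Prop :=
  [/\ M 0 = 1, M 1 = D, (forall v, v < nvars -> M (reg v) = vs s v) &
      forall a i, a < 8 -> M (D + 8 * i + a) = ar s a i].

Lemma bounds_fixed_modv bs c v : bounds_fixed bs c -> v \in bs -> ~~ modv v c.
Proof.
move=> + vb; elim: c => //=; try by move=> u *; apply: contraTneq vb => <-.
- by move=> c1 IH1 c2 IH2 /andP[? ?]; rewrite negb_or IH1 ?IH2.
- by move=> u c1 IH1 c2 IH2 /andP[? ?]; rewrite negb_or IH1 ?IH2.
- move=> u b c IH /and3P[_ ub h]; rewrite negb_or IH // andbT.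
  by apply: contraNneq ub => ->.
Qed.

Section Simulation.
Variable D : nat.
Hypothesis D_ge : nvars + 4 <= D.

Lemma represents_ext s s' M : vs s =1 vs s' -> ar s = ar s' ->
  represents D s M -> represents D s' M.
Proof. by move=> ev ea [? ? hv ha]; split=> // *; rewrite -?ea -?ev ?hv ?ha. Qed.

Lemma represents_setv s M v x : v < nvars -> represents D s M ->
  represents D (setv s v x) (upd M (reg v) x).
Proof.
move=> vn [M0 M1 Mv Ma]; rewrite /upd /reg; split=> //=.
- by rewrite addn4.
- by rewrite addn4.
- by move=> u un; rewrite eqn_add2r /upd Mv.
- move=> a i a8; case: eqP => [e|_]; last exact: Ma.
  by move: D_ge vn; rewrite /nvars in e *; lia.
Qed.

Lemma represents_temp s M r x : 1 < r < 4 -> represents D s M ->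
  represents D s (upd M r x).
Proof.
move=> rr [M0 M1 Mv Ma]; rewrite /upd; split=> //=.
- by case: r rr.
- by case: r rr => [|[|r]].
- by move=> v vn; rewrite /reg; case: eqP => [e|_]; [lia|exact: Mv].
- move=> a i a8; case: eqP => [e|_]; last exact: Ma.
  by move: D_ge; rewrite /nvars; lia.
Qed.

Lemma represents_seta s M a i x : a < 8 -> represents D s M ->
  represents D (seta s a i x) (upd M (D + 8 * i + a) x).
Proof.
move=> a8 [M0 M1 Mv Ma]; have Dg := D_ge; rewrite /nvars in Dg; rewrite /upd; split=> //=.
- by case: eqP => [|_]; [lia|].
- by case: eqP => [|_]; [lia|].
- by move=> v vn; case: eqP => [|_]; [rewrite /reg /nvars in vn *; lia|exact: Mv].
- move=> b k b8; case: (eqVneq b a) => [->|ba].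
    rewrite /upd; case: (eqVneq k i) => [->|ki]; first by rewrite eqxx.
    by case: eqP => [e|_]; [case/eqP: ki; lia|exact: Ma].
  by case: eqP => [e|_]; [case/eqP: ba; lia|exact: Ma].
Qed.

Lemma address_correct s M a i : a < 8 -> i < nvars -> represents D s M ->
  let M' := foldl istep M (address a i) in
  represents D s M' /\ M' 2 = D + 8 * vs s i + a.
Proof.
move=> a8 iN R M'; split; last first.
  have [_ M1 Mv _] := R.
  by rewrite /M' /= /upd /= M1 Mv //; lia.
by rewrite /M' /=; do !apply: represents_temp.
Qed.

Lemma trans_exec (bs : seq nat) B c : wf c -> bounds_fixed bs c ->
  forall s M, represents D s M -> (forall b, b \in bs -> vs s b <= B) ->
  exists M' t, [/\ exec (trans c) M t M', represents D (eval c s) M' & t <= cost B c].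
Proof.
elim: c => [|v k|v a b|v a b|v a i|a i v|c1 IH1 c2 IH2|v c1 IH1 c2 IH2|u b c IH] /=.
- by move=> _ _ s M R _; exists M, 0; split=> //; exact: ExBlock.
- move=> vn _ s M R _; exists (upd M (reg v) k), 1; split=> //.
    exact: (@ExBlock [:: IConst (reg v) k]).
  exact: represents_setv.
- move=> /and3P[vn an bn] _ s M R _; have [_ _ Mv _] := R.
  exists (upd M (reg v) (M (reg a) + M (reg b))), 1; split=> //.
    exact: (@ExBlock [:: IAdd (reg v) (reg a) (reg b)]).
  by rewrite !Mv //; exact: represents_setv.
- move=> /and3P[vn an bn] _ s M R _; have [_ _ Mv _] := R.
  exists (upd M (reg v) (M (reg a) - M (reg b))), 1; split=> //.
    exact: (@ExBlock [:: ISub (reg v) (reg a) (reg b)]).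
  by rewrite !Mv //; exact: represents_setv.
- move=> /and3P[vn a8 iN] _ s M R _.
  have [R' M2] := address_correct a8 iN R.
  exists (foldl istep M (rcons (address a i) (ILoad (reg v) 2))), 7; split=> //.
    exact: (@ExBlock (rcons (address a i) (ILoad (reg v) 2))).
  rewrite foldl_rcons; move: (foldl _ _ _) R' M2 => M' R' M2 /=.
  have [_ _ _ Ma] := R'.
  by rewrite M2 Ma //; exact: represents_setv.
- move=> /and3P[vn a8 iN] _ s M R _.
  have [R' M2] := address_correct a8 iN R.
  exists (foldl istep M (rcons (address a i) (IStore 2 (reg v)))), 7; split=> //.
    exact: (@ExBlock (rcons (address a i) (IStore 2 (reg v)))).
  rewrite foldl_rcons; move: (foldl _ _ _) R' M2 => M' R' M2 /=.
  have [_ _ Mv _] := R'.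
  by rewrite M2 Mv //; exact: represents_seta.
- move=> /andP[w1 w2] /andP[f1 f2] s M R hB.
  have [M1 [t1 [e1 R1 b1]]] := IH1 w1 f1 s M R hB.
  have [|M2 [t2 [e2 R2 b2]]] := IH2 w2 f2 _ _ R1.
    by move=> b bb; rewrite eval_vs ?hB // (bounds_fixed_modv f1).
  exists M2, (t1 + t2); split=> //; last exact: leq_add.
  exact: ExSeq e1 e2.
- move=> /and3P[vn w1 w2] /andP[f1 f2] s M R hB; have [_ _ Mv _] := R.
  rewrite -Mv //; case: ifPn => [nz|/negbNE/eqP z].
    have [M1 [t1 [e1 R1 b1]]] := IH1 w1 f1 s M R hB.
    exists M1, t1.+2; split=> //; first exact: ExIfT.
    by rewrite !ltnS (leq_trans b1) ?leq_addr.
  have [M1 [t1 [e1 R1 b1]]] := IH2 w2 f2 s M R hB.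
  exists M1, t1.+1; split=> //; first exact: ExIfF.
  by rewrite ltnS ltnW // ltnS (leq_trans b1) ?leq_addl.
- move=> /and4P[un bn um wc] /and3P[bb ub fc] s M R hB.
  have [M0 _ Mv _] := R.
  set l := [:: _; _].
  have R1 : represents D (setv s u (vs s b)) (foldl istep M l).
    have R1 := represents_setv (vs s b + 1) un R.
    have := represents_setv (vs s b) un R1.
    rewrite /= Mv // M0; have -> : upd M (reg u) (vs s b + 1) (reg u) = vs s b + 1.
      by rewrite /upd eqxx.
    have -> : upd M (reg u) (vs s b + 1) 0 = 1 by have [] := R1.
    rewrite addnK; apply: represents_ext => // v /=.
    by rewrite /upd; case: eqP.
  (* The three extra steps per iteration are the test, the decrement and the jump back; the final
     [+ 1] is the failing test. *)
  have loop k : forall s' M', represents D s' M' -> vs s' u = k ->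
      (forall v, v \in bs -> vs s' v <= B) ->
      exists M2 t, [/\ exec (RWhile (reg u) (RSeq (RBlock [:: ISub (reg u) (reg u) 0])
        (trans c))) M' t M2, represents D (countdown (eval c) u k s') M2 &
        t <= k * (cost B c).+3 + 1].
    elim: k => [|k IHk] s' M' R' uk hB'; have [M0' _ Mv' _] := R'.
      by exists M', 1; split=> //; apply: ExWhileF; rewrite Mv'.
    have R2 := represents_setv k un R'.
    have [|M3 [t3 [e3 R3 b3]]] := IH wc fc _ _ R2.
      move=> v vb; rewrite /= /upd; case: eqP => [e|_]; last exact: hB'.
      by rewrite -e vb in ub.
    have [||M4 [t4 [e4 R4 b4]]] := IHk _ _ R3.
    - by rewrite eval_vs //= /upd eqxx.
    - move=> v vb; rewrite eval_vs ?(bounds_fixed_modv fc) //= /upd.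
      by case: eqP => [e|_]; [rewrite -e vb in ub|exact: hB'].
    exists M4, ((1 + t3) + t4).+2; split=> //; last by rewrite mulSn; lia.
    apply: ExWhileT e4; first by rewrite Mv' // uk.
    apply: ExSeq e3.
    have := @ExBlock [:: ISub (reg u) (reg u) 0] M' isT.
    by rewrite /= Mv' // uk M0' subn1.
  have [||M2 [t2 [e2 R2 b2]]] := loop (vs s b) _ _ R1.
  - by rewrite /= /upd eqxx.
  - move=> v vb; rewrite /= /upd; case: eqP => [e|_]; last exact: hB.
    by rewrite -e vb in ub.
  exists M2, (2 + t2); split=> //; first by apply: ExSeq e2; exact: (@ExBlock l).
  have := hB _ bb; rewrite -(leq_pmul2r (ltn0Sn (cost B c).+2)); lia.
Qed.
End Simulation.

Fixpoint depth (c : cmd) : nat :=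
  match c with
  | Then c1 c2 | Cond _ c1 c2 => maxn (depth c1) (depth c2)
  | For _ _ c => (depth c).+1
  | _ => 0
  end.

(** Each nesting level of loops contributes one factor [B.+1]; the additive constants are absorbed
    because the power is positive. *)
Lemma cost_poly c B : cost B c <= cost 1 c * B.+1 ^ depth c.
Proof.
have pos k : 0 < B.+1 ^ k by rewrite expn_gt0.
have mono k l : k <= l -> B.+1 ^ k <= B.+1 ^ l by move=> h; rewrite leq_pexp2l.
elim: c => [|v k|v a b|v a b|v a i|a i v|c1 IH1 c2 IH2|v c1 IH1 c2 IH2|u b c IH] //=.
- rewrite mulnDl leq_add //; [apply: leq_trans IH1 _|apply: leq_trans IH2 _].
    by rewrite leq_mul2l mono ?orbT // leq_maxl.
  by rewrite leq_mul2l mono ?orbT // leq_maxr.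
- have h1 : cost B c1 <= cost 1 c1 * B.+1 ^ maxn (depth c1) (depth c2).
    by rewrite (leq_trans IH1) // leq_mul2l mono ?orbT // leq_maxl.
  have h2 : cost B c2 <= cost 1 c2 * B.+1 ^ maxn (depth c1) (depth c2).
    by rewrite (leq_trans IH2) // leq_mul2l mono ?orbT // leq_maxr.
  have := pos (maxn (depth c1) (depth c2)); move: (_ ^ _) h1 h2 => P h1 h2 hP.
  by rewrite !mulSn mulnDl; lia.
- rewrite expnS mul1n; have := pos (depth c); move: (_ ^ _) IH => P h hP.
  have : B * (cost B c).+3 <= B * ((cost 1 c).+3 * P).
    by rewrite leq_mul2l; apply/orP; right; rewrite !mulSn; lia.
  have : 3 <= 3 * P by lia.
  have : 0 <= B * P by [].
  by nia.
Qed.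

(** * Relocating the input *)

Lemma while_exec (I : nat -> memory -> Prop) r c t k M :
  (forall k M, I k M -> M r = k) ->
  (forall k M, I k.+1 M -> exists2 M', exec c M t M' & I k M') ->
  I k M -> exists2 M', exec (RWhile r c) M (k * t.+2 + 1) M' & I 0 M'.
Proof.
move=> hr hc; elim: k M => [|k IH] M h.
  by exists M => //; apply: ExWhileF; exact: hr.
have [M1 e1 h1] := hc _ _ h; have [M2 e2 h2] := IH _ h1.
exists M2 => //; have -> : k.+1 * t.+2 + 1 = (t + (k * t.+2 + 1)).+2 by lia.
by apply: ExWhileT e1 e2; rewrite (hr _ _ h).
Qed.

Definition on_bit (r : nat) (f : bool -> rc) : rc := RIf r (f true) (f false).

Lemma on_bit_exec r f M M' t :
  M r <= 1 -> exec (f (M r == 1)) M t M' ->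
  exists2 t', exec (on_bit r f) M t' M' & t' <= t.+2.
Proof.
case E : (M r) => [|[|//]] _ h.
  by exists t.+1 => //; exact: ExIfF.
by exists t.+2 => //; apply: ExIfT; rewrite ?E.
Qed.

(** Cell 0 is the write pointer and cell 3 holds the array stride 8. The pointer advances before the
    store, so it rests on the last cell written. *)
Definition save_cell (r : nat) : seq instr := [:: IAdd 0 0 3; IStore 0 r].

Definition save_bit (b : bool) : seq instr := IConst 1 b :: save_cell 1.

(* No low cell is known to be free, so the bits in cells 2, 3, 4 are kept in the
   control state while these cells serve to compute the base address. *)
Definition boot_start (b2 b3 b4 : bool) : rc :=
  RSeq (RBlock [:: IConst 2 1; IConst 4 24; IAdd 4 4 0; IAdd 4 4 1; IAdd 3 1 2; ISub 3 3 2])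
  (RSeq (RWhile 3 (RBlock [:: ISub 3 3 2; IAdd 4 4 0]))
  (RBlock ([:: IStore 4 0; IAdd 0 4 3; IConst 3 8] ++ save_cell 1 ++
    save_bit b2 ++ save_bit b3 ++ save_bit b4))).

(** Destinations lie at or above the base and sources below it, so no unread input is destroyed.
    Cells 5 to 7 are saved singly to become registers of the loop that copies the cells from 8 up to
    the base. *)
Definition boot : rc :=
  RSeq (on_bit 2 (fun b2 => on_bit 3 (fun b3 => on_bit 4 (fun b4 => boot_start b2 b3 b4))))
  (RSeq (RBlock (save_cell 5 ++ save_cell 6 ++ save_cell 7 ++
           [:: IConst 6 8; ISub 5 4 6]))
  (RSeq (RWhile 5 (RBlock [:: ISub 5 5 2; ILoad 7 6; IAdd 0 0 3; IStore 0 7; IAdd 6 6 2]))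
        (RBlock [:: IConst 3 0; IAdd 1 4 3; IConst 0 1]))).

Section Boot.
Variables n m : nat.

(** [24] reserves the 4 machine registers and 20 variables; [n + m * n] then takes the base past the
    input, and [m] makes it bound the output length as well. *)
Definition base := 24 + n + m + m * n.

Lemma base_ge : 24 <= base.
Proof. by rewrite /base; lia. Qed.

Variable enc : memory.
Hypotheses (enc0 : enc 0 = n) (enc1 : enc 1 = m).
Hypothesis enc_bit : forall x, 2 <= x -> enc x <= 1.
Hypothesis enc_end : forall x, 2 + n + m * n <= x -> enc x = 0.

Definition saved (x : nat) (M : memory) : Prop :=
  forall y a, a < 8 -> M (base + 8 * y + a) = if (a == 0) && (y < x) then enc y else 0.

(** [x] input cells have been saved, and from cell [l] up to the base the input is still intact in
    place. *)
Definition saving (l x : nat) (M : memory) : Prop :=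
  [/\ M 0 + 8 = base + 8 * x, M 2 = 1 /\ M 3 = 8, M 4 = base, saved x M &
      forall z, l <= z < base -> M z = enc z].

Lemma saved_reg x M r v : r < base -> saved x M -> saved x (upd M r v).
Proof.
move=> rb h y a a8; rewrite /upd; case: eqP => [e|_]; first by lia.
exact: h.
Qed.

Lemma saved_store x M : saved x M -> saved x.+1 (upd M (base + 8 * x) (enc x)).
Proof.
move=> h y a a8; rewrite /upd; case: eqP => [e|ne].
  have [-> ->] : a = 0 /\ y = x by lia.
  by rewrite ltnSn.
rewrite h // [y < x.+1]ltnS [y <= x]leq_eqVlt; case: (eqVneq a 0) => //= a0.
by case: eqP => // yx; rewrite a0 yx addn0 in ne.
Qed.

Lemma saving_save_cell l x M r : 4 < l -> 0 < r -> r < base -> M r = enc x -> saving l x M ->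
  saving l x.+1 (foldl istep M (save_cell r)).
Proof.
move=> l4 r0 rb Mr [M0 [M2 M3] M4 Ms Mz]; have bg := base_ge.
have -> : foldl istep M (save_cell r) = upd (upd M 0 (base + 8 * x)) (base + 8 * x) (enc x).
  rewrite /= M3 M0; congr upd; last by rewrite /upd eqn0Ngt r0.
split; rewrite /upd.
- by case: eqP => [|_]; rewrite ?eqxx; lia.
- by do 2! [case: eqP => [|_]; first lia].
- by case: eqP => [|_]; first lia.
- by apply: saved_store; apply: saved_reg => //; lia.
- move=> z zb; do 2! [case: eqP => [|_]; first lia]; exact: Mz.
Qed.

Lemma saving_set l x M r v : r \in [:: 1; 5; 6; 7] -> r < l -> saving l x M ->
  saving l x (upd M r v).
Proof.
move=> rr rl [M0 [M2 M3] M4 Ms Mz]; have bg := base_ge.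
have rb : r < base by move: rr; rewrite !inE; lia.
have ne k : k \in [:: 0; 2; 3; 4] -> upd M r v k = M k.
  by rewrite /upd; case: eqP => // ->; move: rr; rewrite !inE; lia.
split; rewrite ?ne //; first exact: saved_reg.
by move=> z zb; rewrite /upd; case: eqP => [|_]; [lia|exact: Mz].
Qed.

Lemma saving_save_bit l x M (b : bool) : 4 < l -> enc x = b -> saving l x M ->
  saving l x.+1 (foldl istep M (save_bit b)).
Proof.
move=> l4 eb h; rewrite -[foldl _ _ _]/(foldl istep (upd M 1 b) (save_cell 1)).
apply: saving_save_cell => //.
by apply: saving_set => //; lia.
Qed.

Lemma saved_init : saved 0 enc.
Proof. by move=> y a a8; rewrite ltn0 andbF enc_end // /base; lia. Qed.

Lemma boot_start_exec (b2 b3 b4 : bool) : enc 2 = b2 -> enc 3 = b3 -> enc 4 = b4 ->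
  exists2 M, exec (boot_start b2 b3 b4) enc (m * 4 + 21) M & saving 5 5 M.
Proof.
move=> e2 e3 e4; have bg := base_ge.
pose I k M := [/\ M 0 = n /\ M 1 = m, M 2 = 1 /\ M 3 = k, M 4 + k * n = base, saved 0 M &
  forall z, 5 <= z -> M z = enc z].
have [M1 x1 [[h0 h1] [h2 h3] h4 hs hz]] :
  exists2 M1, exec (RWhile 3 (RBlock [:: ISub 3 3 2; IAdd 4 4 0]))
    (foldl istep enc [:: IConst 2 1; IConst 4 24; IAdd 4 4 0; IAdd 4 4 1; IAdd 3 1 2; ISub 3 3 2])
    (m * 4 + 1) M1 & I 0 M1.
  apply: (@while_exec I 3 _ 2); first by move=> k M [_ []].
    move=> k M [[h0 h1] [h2 h3] h4 hs hz].
    eexists; first exact: (@ExBlock [:: ISub 3 3 2; IAdd 4 4 0]).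
    rewrite /=; split=> //.
    - by split; rewrite /upd //= h3 h2 subn1.
    - by rewrite /upd /= h0; lia.
    - by move=> [|[|[|[|[|z]]]]] // zb; rewrite /upd /=; exact: hz.
  rewrite /=; split=> //.
  - by split; rewrite /upd //= enc1 addnK.
  - by rewrite /upd /= enc0 enc1 /base; lia.
  - by do 6! [apply: saved_reg; first lia]; exact: saved_init.
  - by move=> [|[|[|[|[|z]]]]].
set l0 := [:: IStore 4 0; IAdd 0 4 3; IConst 3 8].
have s1 : saving 5 1 (foldl istep M1 l0).
  have b4' : M1 4 = base by rewrite -h4; lia.
  have -> : foldl istep M1 l0 = upd (upd (upd M1 (base + 8 * 0) (enc 0)) 0 base) 3 8.
    rewrite /= b4' h0 enc0 addn0; congr upd; congr upd.
    by rewrite /upd; do ?[case: eqP => [|_]; first lia]; rewrite b4' h3 addn0.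
  split; rewrite /upd /=.
  - by lia.
  - by do ?[case: eqP => [|_]; first lia].
  - by do ?[case: eqP => [|_]; first lia].
  - by do 2! [apply: saved_reg; first lia]; exact: saved_store.
  - move=> z zb; do ?[case: eqP => [|_]; first lia]; apply: hz; lia.
have M1_1 : foldl istep M1 l0 1 = enc 1.
  rewrite /= /upd /= enc1; case: eqP => [|_]; last by [].
  by lia.
eexists.
  have -> : m * 4 + 21 = 6 + (m * 4 + 1 + 14) by lia.
  apply: ExSeq; first exact: ExBlock.
  apply: ExSeq; first exact: x1.
  exact: ExBlock.
rewrite !foldl_cat; do 3! [apply: saving_save_bit => //].
by apply: saving_save_cell => //; lia.
Qed.

Lemma boot_exec : exists M t,
  [/\ exec boot enc t M, t <= base * 7 + m * 4 + 40, M 0 = 1, M 1 = base &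
      forall a y, a < 8 -> M (base + 8 * y + a) = if a == 0 then enc y else 0].
Proof.
have bg := base_ge.
have bitE r : 2 <= r -> enc r = (enc r == 1) :> nat.
  by move=> /enc_bit; case: (enc r) => [|[|]].
have [M1 x1 s1] := boot_start_exec (bitE 2 isT) (bitE 3 isT) (bitE 4 isT).
have [t4 x4 b4] := @on_bit_exec 4 (fun b => boot_start (enc 2 == 1) (enc 3 == 1) b)
  enc M1 _ (@enc_bit 4 isT) x1.
have [t3 x3 b3] := @on_bit_exec 3 (fun b => on_bit 4 (fun b' => boot_start (enc 2 == 1) b b'))
  enc M1 _ (@enc_bit 3 isT) x4.
have [t2 x2 b2] := @on_bit_exec 2
  (fun b => on_bit 3 (fun b' => on_bit 4 (fun b'' => boot_start b b' b'')))
  enc M1 _ (@enc_bit 2 isT) x3.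
set l1 := [:: IConst 6 8; ISub 5 4 6].
pose I k M := saving 8 (base - k) M /\ [/\ M 5 = k, M 6 = base - k & k <= base - 8].
have i1 : I (base - 8) (foldl istep M1 (save_cell 5 ++ save_cell 6 ++ save_cell 7 ++ l1)).
  have cell x M : saving 5 x M -> 4 < x < base -> saving 5 x.+1 (foldl istep M (save_cell x)).
    move=> h xb; have [_ _ _ _ hz] := h.
    by apply: saving_save_cell; rewrite ?hz //; lia.
  rewrite !foldl_cat.
  have s2 := cell 5 _ s1 (ltac:(lia)); move: (foldl istep M1 _) s2 => M2 s2.
  have s3 := cell 6 _ s2 (ltac:(lia)); move: (foldl istep M2 _) s3 => M3 s3.
  have s4 := cell 7 _ s3 (ltac:(lia)); move: (foldl istep M3 _) s4 => M4 s4.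
  rewrite /= (_ : upd M4 6 8 4 = base); last by have [] := s4.
  rewrite /I subKn; last by lia.
  rewrite (_ : upd M4 6 8 6 = 8) //.
  split; last by rewrite /upd /=; split=> //; lia.
  apply: saving_set => //; apply: saving_set => //.
  have [? ? ? ? hz] := s4; split=> // z zb; apply: hz; lia.
set lb := [:: ISub 5 5 2; ILoad 7 6; IAdd 0 0 3; IStore 0 7; IAdd 6 6 2].
have body k M : I k.+1 M -> exists2 M', exec (RBlock lb) M 5 M' & I k M'.
  move=> [sM [h5 h6 kb]].
  eexists; first exact: ExBlock.
  have [_ [h2 h3] _ _ hz] := sM.
  set M' := upd (upd M 5 k) 7 (enc (base - k.+1)).
  have eM' : istep (istep M (ISub 5 5 2)) (ILoad 7 6) = M'.
    rewrite /= h5 h2 subn1 /= (_ : upd M 5 k 6 = base - k.+1) // /M'; congr upd.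
    by rewrite {1}/upd; case: eqP => [|_]; [lia|apply: hz; lia].
  have -> : foldl istep M lb = foldl istep (foldl istep M' (save_cell 7)) [:: IAdd 6 6 2].
    by rewrite -eM'.
  have sM' : saving 8 (base - k.+1) M' by do 2! [apply: saving_set => //].
  have sM2 : saving 8 (base - k) (foldl istep M' (save_cell 7)).
    have -> : base - k = (base - k.+1).+1 by lia.
    by apply: saving_save_cell => //; lia.
  have [h0 _ _ _ _] := sM'.
  have low z : 0 < z < base -> foldl istep M' (save_cell 7) z = M' z.
    move=> zb; rewrite /= {1}/upd; case: eqP => [e|_].
      by move: e; rewrite /upd /= -[M' 3]/(M 3) h3; lia.
    by rewrite /upd; case: eqP => // ?; lia.
  move: (foldl istep M' _) sM2 low => M2 sM2 low.
  split; first by apply: saving_set.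
  by rewrite /= /upd /= !low ?/M' /upd /= ?h6 ?h2; split; lia.
have [|M3 x3' [s3 _]] := while_exec (r := 5) _ body i1; first by move=> k M [_ []].
rewrite subn0 in s3.
exists (foldl istep M3 [:: IConst 3 0; IAdd 1 4 3; IConst 0 1]).
eexists; split.
- apply: ExSeq x2 _; apply: ExSeq; first exact: ExBlock.
  apply: ExSeq; first exact: x3'.
  exact: ExBlock.
- rewrite /=; lia.
- by [].
- by rewrite /= /upd /= addn0; have [] := s3.
- move=> a y a8; rewrite /=; have [_ _ _ hs _] := s3.
  have h : saved base (upd (upd (upd M3 3 0) 1 (upd M3 3 0 4 + upd M3 3 0 3)) 0 1).
    by do 3! [apply: saved_reg; first lia].
  (* Cells from [base] on were never copied, but the input is zero there. *)
  rewrite h //; case: (a == 0) => //=; case: ltnP => // by_.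
  by rewrite enc_end // ; move: by_; rewrite /base; lia.
Qed.
End Boot.

(** * Writing the output *)

(* Array 1 is the output array and variable 1 the number of entries. *)
Definition epilogue : rc :=
  RSeq (RBlock [:: IConst 3 8; ISub 2 5 3; IConst 4 65; IAdd 4 4 1; IConst 6 8])
  (RSeq (RWhile 2 (RBlock [:: ISub 2 2 0; ILoad 7 4; IStore 6 7; IAdd 4 4 3; IAdd 6 6 0]))
  (RSeq (RBlock (flatten [seq [:: IConst j (8 * j + 1); IAdd j j 1] | j <- [:: 0; 2; 3; 4; 5; 6; 7]]
                 ++ [:: IConst 1 8; ISub 1 2 1]))
        (RBlock [seq ILoad j j | j <- iota 0 8]))).

(** The output must finally overwrite the registers themselves. Each low cell first receives the
    address of its own entry and then loads through itself; since all addresses are at least [k], no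
    load reads a cell already replaced. *)
Lemma self_loads M k : (forall j, j < k -> k <= M j) -> forall x,
  foldl istep M [seq ILoad j j | j <- iota 0 k] x = if x < k then M (M x) else M x.
Proof.
move=> h.
have gen l : l <= k -> forall x,
    foldl istep M [seq ILoad j j | j <- iota 0 l] x = if x < l then M (M x) else M x.
  elim: l => [//|l IH] lk x.
  have -> : iota 0 l.+1 = iota 0 l ++ [:: l] by rewrite -[l.+1]addn1 iotaD.
  rewrite map_cat foldl_cat /=.
  move/(_ (ltnW lk)): IH; move: (foldl _ _ _) => M' IH.
  rewrite /upd ltnS; case: (ltngtP x l) => [xl|xl|->].
  - by rewrite IH xl.
  - by rewrite IH ltnNge (ltnW xl).
  - by rewrite !IH ltnn ltnNge (leq_trans (ltnW lk) (h _ lk)).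
exact: gen.
Qed.

Lemma epilogue_exec D s M : 24 <= D -> represents D s M -> vs s 1 <= D ->
  exists M' t, [/\ exec epilogue M t M', t <= vs s 1 * 7 + 40 &
    forall j, j < vs s 1 -> M' j = ar s 1 j].
Proof.
move=> D24 [h0 h1 hv ha] mD; have h5 := hv 1 isT; rewrite -[reg 1]/5 in h5.
set m := vs s 1 in mD h5 *.
(* Subtraction is truncated: for [m < 8] the loop does not run and the write position stays at 8,
   whence [(m - 8) + 8]. *)
pose I k M' := [/\ M' 0 = 1 /\ M' 1 = D, M' 2 = k /\ M' 3 = 8,
  [/\ M' 4 = D + 8 * M' 6 + 1, 8 <= M' 6 & M' 6 + k = (m - 8) + 8],
  (forall y, D <= y -> M' y = M y) & forall j, 8 <= j < M' 6 -> M' j = ar s 1 j].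
(* [65 = 8 * 8 + 1] is the offset of entry 8 of array 1. *)
set l0 := [:: IConst 3 8; ISub 2 5 3; IConst 4 65; IAdd 4 4 1; IConst 6 8].
have i0 : I (m - 8) (foldl istep M l0).
  split; try by rewrite /= /upd /= ?h0 ?h1 ?h5.
  - by rewrite /= /upd /= h1; split; lia.
  - by move=> y yD; rewrite /= /upd; do ?[case: eqP => [|_]; first lia].
  - by move=> j /andP[j8]; rewrite /= {1}/upd /= ltnNge j8.
set lb := [:: ISub 2 2 0; ILoad 7 4; IStore 6 7; IAdd 4 4 3; IAdd 6 6 0].
have body k M1 : I k.+1 M1 -> exists2 M2, exec (RBlock lb) M1 5 M2 & I k M2.
  move=> [[g0 g1] [g2 g3] [g4 g8 g6] gD gj].
  eexists; first exact: ExBlock.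
  (* Since [m <= D], writing stays below the arrays, so no entry still to be read is lost. *)
  have [x6 x6D] : 8 <= M1 6 /\ M1 6 < D by lia.
  set x := M1 6 in g4 g8 g6 gj x6 x6D.
  have -> : foldl istep M1 lb =
    upd (upd (upd (upd (upd M1 2 k) 7 (ar s 1 x)) x (ar s 1 x)) 4 (D + 8 * x.+1 + 1)) 6 x.+1.
    rewrite [foldl _ _ _]/= g2 g0 subn1 /=.
    have -> : upd M1 2 k 4 = D + 8 * x + 1 by [].
    have -> : upd M1 2 k (D + 8 * x + 1) = ar s 1 x.
      by rewrite /upd; case: eqP => [|_]; [lia|rewrite gD ?ha //; lia].
    set M2 := upd (upd M1 2 k) 7 (ar s 1 x).
    have -> : M2 6 = x by [].
    have -> : M2 7 = ar s 1 x by [].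
    have low z : z < 8 -> upd M2 x (ar s 1 x) z = M2 z.
      by rewrite {1}/upd; case: eqP => // ->; lia.
    rewrite !low // (_ : M2 4 = D + 8 * x + 1) // (_ : M2 3 = 8) //.
    rewrite (_ : D + 8 * x + 1 + 8 = D + 8 * x.+1 + 1); last by lia.
    set M3 := upd _ 4 _.
    rewrite (_ : M3 6 = x); last by rewrite /M3 {1}/upd /= low.
    by rewrite (_ : M3 0 = 1) ?addn1 // /M3 {1}/upd /= low.
  have sm z : z < 8 -> (z == x) = false by move=> z8; apply/eqP; lia.
  split; rewrite /upd /=; rewrite ?sm //=.
  - by split; lia.
  - by move=> y yD; do ?[case: eqP => [|_]; first lia]; exact: gD.
  - move=> j jx; do 2?[case: eqP => [|_]; first lia].
    case: eqP => [->//|jx']; do 2?[case: eqP => [|_]; first lia].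
    apply: gj; lia.
have [|M1 x1 [[g0 g1] _ [_ _ g6] gD gj]] := while_exec (r := 2) _ body i0.
  by move=> k M1 [_ []].
(* Cell 1 holds the base that the other address computations need, so its own address comes last, as
   that of cell 2 minus the stride 8. *)
rewrite /epilogue; set la := _ ++ [:: IConst 1 8; ISub 1 2 1].
have la_low j : j < 8 -> foldl istep M1 la j = D + 8 * j + 1.
  by do 8?[case: j => [|j]]; rewrite //= /upd /= g1; lia.
have la_high y : 8 <= y -> foldl istep M1 la y = M1 y.
  by do 8?[case: y => [|y]].
eexists; eexists; split.
- apply: ExSeq; first exact: (@ExBlock l0).
  apply: ExSeq; first exact: x1.
  by apply: ExSeq; exact: ExBlock.
- by rewrite /=; lia.
move=> j jm; rewrite self_loads; last by move=> i i8; rewrite la_low //; lia.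
case: ltnP => j8; last first.
  rewrite la_high // gj //; lia.
rewrite (la_low j) // la_high; last by lia.
by rewrite gD ?ha //; lia.
Qed.

(** * The algorithm *)

Notation "c1 ;; c2" := (Then c1 c2) (at level 60, right associativity).

(* Variables: 0 = n, 1 = m, 2 = the constant 1, 3 and 4 = offsets of rows j
   and k of the incidence matrix, 5 = j, 6 = k, 7 = i, 15 = candidate,
   18 = round, 19 = end of the matrix, the others are temporaries.
   Arrays: 0 = input, 1 = output, 2 = red partner, 3 = blue partner,
   4 = live, 5 = has a red feature, 6 = has a blue feature. *)
Definition load_sizes : cmd := Const 8 0;; Get 0 0 8;; Const 2 1;; Get 1 0 2.

Definition matrix_end : cmd :=
  (Const 3 2;; Plus 3 3 0);; For 5 1 (Plus 3 3 0);; Const 8 0;; Plus 19 3 8.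

Definition load_entry (row v : nat) : cmd := Plus 8 row 7;; Get v 0 8.
Definition load_target : cmd := Const 8 2;; Plus 8 8 7;; Get 12 0 8.
(** The sum of the two truncated differences vanishes only for [j = k]; an exemplar must not become
    its own partner. *)
Definition compare_jk : cmd :=
  Minus 11 5 6;; Minus 12 6 5;; Plus 11 11 12;; Cond 11 Skip (Const 10 0).
Definition mark (a b : nat) : cmd := Put a 5 2;; Cond 10 (Put b 5 6) Skip.

Definition scan_cell : cmd :=
  load_entry 3 9;;
  Cond 9 (load_entry 4 10;; compare_jk;; load_target;; Cond 12 (mark 6 3) (mark 5 2))
         Skip.

(** The row offset is decremented before use, so the enclosing loop starts it at the end of the
    matrix. *)
Definition scan_pair : cmd := Minus 4 4 0;; For 7 0 scan_cell.
Definition scan_row : cmd :=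
  (Minus 3 3 0;; Put 2 5 1;; Put 3 5 1;; Const 8 0;; Plus 4 19 8);; For 6 1 scan_pair.
Definition scan : cmd := For 5 1 scan_row.

(** Index [m], the missing partner, is declared to have a red feature and to be its own partner in
    both colours: an exemplar without blue partner then passes the test for being live. *)
Definition classify : cmd :=
  (Put 5 1 2;; Put 2 1 1;; Put 3 1 1);;
  For 5 1 (Get 9 5 5;;
    Cond 9 (Get 10 6 5;;
            Cond 10 ((Get 17 3 5;; Get 11 5 17);; Cond 11 (Put 4 5 2) Skip) Skip)
           (Put 1 5 2)).

Definition test_good (g x : nat) : cmd :=
  (Const g 0;; Get 9 4 x);;
  Cond 9 ((Get 10 2 x;; Get 11 4 10);;
        Cond 11 (Get 12 3 x;; Minus 9 10 12;; Minus 11 12 10;; Plus g 9 11) Skip)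
       Skip.

(** A path end always replaces the candidate, whereas a good element with a good blue partner is
    taken only if there is no candidate yet. The final candidate is thus a path end unless only
    cycles remain. *)
Definition consider : cmd :=
  test_good 13 5;;
  Cond 13 (Get 17 3 5;; test_good 14 17;;
         Cond 14 (Minus 11 1 15;; Cond 11 Skip (Plus 15 5 8)) (Plus 15 5 8))
        Skip.

(** When no candidate was found, all writes go to index [m] and are harmless, so no test is made. *)
Definition commit : cmd :=
  Get 16 2 15;; Put 1 15 2;; Put 1 16 2;; Get 17 3 15;; Get 9 3 16;;
  Put 4 15 8;; Put 4 16 8;; Put 4 17 8;; Put 4 9 8.

Definition greedy_round : cmd :=
  (Const 8 0;; Plus 15 1 8);; For 5 1 consider;; commit.

Definition main : cmd := matrix_end;; scan;; classify;; For 18 1 greedy_round.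

(** * Correctness of the individual commands *)

Arguments eval : simpl never.

Lemma eval_then c1 c2 s : eval (c1 ;; c2) s = eval c2 (eval c1 s).
Proof. by []. Qed.

Lemma eval_cond v c1 c2 s :
  eval (Cond v c1 c2) s = if vs s v != 0 then eval c1 s else eval c2 s.
Proof. by []. Qed.

Lemma setv_ar s v x : ar (setv s v x) = ar s.
Proof. by []. Qed.

Lemma seta_ar s a i x b k :
  ar (seta s a i x) b k = if (b == a) && (k == i) then x else ar s b k.
Proof. by rewrite /seta /=; case: eqP => [->|//]; rewrite /upd. Qed.

Lemma seta_vs s a i x : vs (seta s a i x) = vs s.
Proof. by []. Qed.

(** [D] is the region visited so far and [d] the default. Which witness supplied the value is left
    open, since the partner of a mixed exemplar is unique anyway. *)
Definition hit (D : nat -> nat -> bool) (d : nat) (cond : nat -> nat -> bool)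
    (val : nat -> nat) (x : nat) : Prop :=
  (x = d /\ forall k i, D k i -> ~~ cond k i) \/
  (exists k i, [/\ D k i, cond k i & x = val k]).

Lemma hit_ext D D' d cond val x : D =2 D' -> hit D d cond val x -> hit D' d cond val x.
Proof.
move=> e [[-> h]|[k [i [Dk ck ->]]]]; [left|right].
  by split=> // k i; rewrite -e; exact: h.
by exists k, i; rewrite -e.
Qed.

Lemma hit_step D D' d cond val x k i :
  (forall k' i', D' k' i' = D k' i' || ((k' == k) && (i' == i))) ->
  hit D d cond val x -> hit D' d cond val (if cond k i then val k else x).
Proof.
move=> e h; case: ifPn => c.
  by right; exists k, i; rewrite e !eqxx orbT.
case: h => [[-> h]|[k' [i' [Dk ck ->]]]]; [left|right].
  by split=> // k' i'; rewrite e => /orP[/h//|/andP[/eqP-> /eqP->]].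
by exists k', i'; rewrite e Dk.
Qed.

Section Scan.
Variables (n m : nat) (enc : nat -> nat).

Definition tb (i : nat) : bool := enc (2 + i) != 0.
Definition sb (j i : nat) : bool := enc (2 + n + j * n + i) != 0.
Definition mono_at (b : bool) (j k i : nat) : bool := sb j i && (tb i == b).
Definition meet_at (b : bool) (j k i : nat) : bool :=
  [&& mono_at b j k i, sb k i & j != k].

Definition scanned D (s : state) (j : nat) : Prop :=
  [/\ hit D 0 (mono_at false j) (fun => 1) (ar s 5 j),
      hit D 0 (mono_at true j) (fun => 1) (ar s 6 j),
      hit D m (meet_at false j) id (ar s 2 j) &
      hit D m (meet_at true j) id (ar s 3 j)].

Lemma scanned_ext D D' s j : D =2 D' -> scanned D s j -> scanned D' s j.
Proof. by move=> e [h1 h2 h3 h4]; split; apply: hit_ext e _. Qed.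

Lemma scanned_ar D s s' j : (forall a, ar s' a j = ar s a j) ->
  scanned D s j -> scanned D s' j.
Proof. by move=> e [h1 h2 h3 h4]; split; rewrite e. Qed.

Lemma compare_jk_correct s :
  (vs (eval compare_jk s) 10 != 0) = (vs s 10 != 0) && (vs s 5 != vs s 6).
Proof.
rewrite /compare_jk !eval_then; set s1 := eval (Plus 11 11 12) _.
have e11 : vs s1 11 = (vs s 5 - vs s 6) + (vs s 6 - vs s 5) by [].
have e10 : vs s1 10 = vs s 10 by [].
rewrite eval_cond e11; case: (eqVneq (vs s 5) (vs s 6)) => [->|ne].
  by rewrite subnn andbF.
by rewrite (_ : _ + _ != 0) ?andbT //; lia.
Qed.

Lemma mark_at s a b j : vs s 2 = 1 -> vs s 5 = j -> a != b ->
  [/\ ar (eval (mark a b) s) a j = 1,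
      ar (eval (mark a b) s) b j = (if vs s 10 != 0 then vs s 6 else ar s b j) &
      forall c j', (c != a) && (c != b) || (j' != j) ->
        ar (eval (mark a b) s) c j' = ar s c j'].
Proof.
move=> v2 v5 ab; rewrite /mark eval_then eval_cond seta_vs.
have e c k : ar (eval (Put a 5 2) s) c k = if (c == a) && (k == j) then 1 else ar s c k.
  by rewrite seta_ar v5 v2.
have f c k : ar (eval (Put b 5 6) (eval (Put a 5 2) s)) c k =
    if (c == b) && (k == j) then vs s 6 else ar (eval (Put a 5 2) s) c k.
  by rewrite seta_ar seta_vs v5.
split.
- by case: ifP => _; rewrite ?f e !eqxx // (negPf ab).
- by case: ifP => _; rewrite ?f ?e !eqxx // (eq_sym b) (negPf ab).
- move=> c j' /orP[/andP[/negPf ca /negPf cb]|/negPf jj]; case: ifP => _;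
  by rewrite ?f e ?ca ?cb ?jj ?andbF.
Qed.

Lemma scan_cell_correct s j k i : ar s 0 = enc ->
  vs s 2 = 1 -> vs s 3 = 2 + n + j * n -> vs s 4 = 2 + n + k * n ->
  vs s 5 = j -> vs s 6 = k -> vs s 7 = i ->
  let s' := eval scan_cell s in
  [/\ ar s' 5 j = (if mono_at false j k i then 1 else ar s 5 j),
      ar s' 6 j = (if mono_at true j k i then 1 else ar s 6 j),
      ar s' 2 j = (if meet_at false j k i then k else ar s 2 j),
      ar s' 3 j = (if meet_at true j k i then k else ar s 3 j) &
      forall a j', j' != j -> ar s' a j' = ar s a j'].
Proof.
move=> e v2 v3 v4 v5 v6 v7 /=.
rewrite /scan_cell eval_then eval_cond; set s1 := eval (load_entry 3 9) s.
have -> : (vs s1 9 != 0) = sb j i by rewrite /sb -e -v3 -v7.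
rewrite /meet_at /mono_at; case: ifP => //= _.
rewrite !eval_then; set s2 := eval (load_entry 4 10) s1.
have w10 : (vs s2 10 != 0) = sb k i by rewrite /sb -e -v4 -v7.
set s3 := eval compare_jk s2.
have u10 : (vs s3 10 != 0) = sb k i && (j != k).
  by rewrite compare_jk_correct w10 -v5 -v6.
set s4 := eval load_target s3; have arE a : ar s4 a = ar s a by rewrite !eval_ar.
have x12 : (vs s4 12 != 0) = tb i.
  by rewrite /tb -e -v7 -[vs s 7]/(vs s2 7) -(eval_vs (c := compare_jk) (v := 7)) //
     -[ar s 0]/(ar s2 0) -(eval_ar (c := compare_jk) (a := 0)).
have x10 : (vs s4 10 != 0) = sb k i && (j != k) by rewrite -u10.
have x v : v \in [:: 2; 5; 6] -> vs s4 v = vs s v.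
  by rewrite !inE => /or3P[]/eqP->; rewrite !eval_vs.
have x2 : vs s4 2 = 1 by rewrite x.
have x5 : vs s4 5 = j by rewrite x.
have x6 : vs s4 6 = k by rewrite x.
rewrite eval_cond x12; case: (tb i) => /=.
  have [] := @mark_at s4 6 3 j x2 x5 isT.
  by move=> h6 h3 o; split; rewrite ?h6 ?h3 ?x10 ?x6 ?o ?arE // => a j' ne;
    rewrite o ?arE // ne orbT.
have [] := @mark_at s4 5 2 j x2 x5 isT.
by move=> h6 h3 o; split; rewrite ?h6 ?h3 ?x10 ?x6 ?o ?arE // => a j' ne;
  rewrite o ?arE // ne orbT.
Qed.

Definition from_row (y k i : nat) : bool := (i < n) && (y <= k < m).

Lemma scan_pair_correct s j k : k < m -> ar s 0 = enc ->
  vs s 0 = n -> vs s 2 = 1 -> vs s 3 = 2 + n + j * n -> vs s 4 = 2 + n + k.+1 * n ->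
  vs s 5 = j -> vs s 6 = k -> scanned (from_row k.+1) s j ->
  [/\ scanned (from_row k) (eval scan_pair s) j, vs (eval scan_pair s) 4 = 2 + n + k * n &
      forall a j', j' != j -> ar (eval scan_pair s) a j' = ar s a j'].
Proof.
move=> km e v0 v2 v3 v4 v5 v6 h; rewrite /scan_pair eval_then.
set s0 := eval (Minus 4 4 0) s.
have s0v4 : vs s0 4 = 2 + n + k * n by rewrite [vs s0 4]/(vs s 4 - vs s 0) v0 v4; lia.
(* As loops count down, the visited cells are the rows of index larger than [k] and, in row [k], the
   columns from [x] on. *)
pose D x k' i' := (i' < n) && ((k < k' < m) || ((k' == k) && (x <= i'))).
pose I x s' := [/\ ar s' 0 = enc /\ vs s' 2 = 1,
  vs s' 3 = 2 + n + j * n /\ vs s' 4 = 2 + n + k * n, vs s' 5 = j /\ vs s' 6 = k,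
  (forall a j', j' != j -> ar s' a j' = ar s a j') & scanned (D x) s' j].
have [_ [_ ?] _ ? h'] : I 0 (eval (For 7 0 scan_cell) s0).
  apply: for_ind.
  - have -> : vs s0 0 = n by [].
    split=> //; last apply: scanned_ext h.
    move=> k' i'; rewrite /from_row /D; case: (ltnP i' n) => // ?.
    by rewrite andbF orbF.
  - move=> x s' xn [[e' w2] [w3 w4] [w5 w6] fr sc].
    set s1 := setv s' 7 x.
    have [c5 c6 c2 c3 fr1] := @scan_cell_correct s1 j k x e' w2 w3 w4 w5 w6 erefl.
    split=> //.
    + by rewrite eval_ar // eval_vs.
    + by rewrite !eval_vs.
    + by rewrite !eval_vs.
    + by move=> a j' ne; rewrite fr1 // fr.
    + have DS k' i' : D x k' i' = D x.+1 k' i' || ((k' == k) && (i' == x)).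
        rewrite /D; have : x < n by rewrite -v0.
        by move: (ltngtP k' k) (ltngtP i' x) => *; lia.
      case: sc => h5 h6 h2 h3.
      by split; rewrite ?c5 ?c6 ?c2 ?c3; apply: hit_step => //; exact: DS.
split=> //; apply: scanned_ext h' => k' i'; rewrite /D /from_row.
by lia.
Qed.

Lemma scan_row_correct s j : j < m -> ar s 0 = enc ->
  vs s 0 = n -> vs s 1 = m -> vs s 2 = 1 -> vs s 3 = 2 + n + j.+1 * n ->
  vs s 19 = 2 + n + m * n -> vs s 5 = j -> ar s 5 j = 0 -> ar s 6 j = 0 ->
  [/\ scanned (from_row 0) (eval scan_row s) j, vs (eval scan_row s) 3 = 2 + n + j * n &
      forall a j', j' != j -> ar (eval scan_row s) a j' = ar s a j'].
Proof.
move=> jm e v0 v1 v2 v3 v19 v5 a5 a6; rewrite /scan_row eval_then.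
set s0 := eval _ s.
have u4 : vs s0 4 = vs s 19 + 0 by [].
have u3 : vs s0 3 = vs s 3 - vs s 0 by [].
have u b k : ar s0 b k = if ((b == 3) || (b == 2)) && (k == j) then m else ar s b k.
  rewrite -[s0]/(eval (Plus 4 19 8) (eval (Const 8 0) (seta (seta (setv s 3 (vs s 3 - vs s 0))
    2 (vs s 5) (vs s 1)) 3 (vs s 5) (vs s 1)))) !eval_ar // !seta_ar v1 v5.
  by case: (b == 3); case: (b == 2); case: (k == j).
pose I y s' := [/\ [/\ ar s' 0 = enc, vs s' 0 = n & vs s' 2 = 1],
  vs s' 3 = 2 + n + j * n /\ vs s' 4 = 2 + n + y * n, vs s' 5 = j,
  (forall a j', j' != j -> ar s' a j' = ar s a j') & scanned (from_row y) s' j].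
have [_ [? ?] _ ? ?] : I 0 (eval (For 6 1 scan_pair) s0); last by split.
apply: for_ind.
- have -> : vs s0 1 = m by [].
  split.
  + by rewrite eval_ar.
  + by rewrite -[vs _ 3]/(vs s0 3) -[vs _ 4]/(vs s0 4) u3 u4 v19 v3 v0; split; lia.
  + by [].
  + by move=> a j' ne; rewrite u (negPf ne) andbF.
  + have no y : from_row m y =1 xpred0 by move=> i; rewrite /from_row; lia.
    by split; left; rewrite u /= ?eqxx; split=> // k i; rewrite no.
- move=> y s' ym [[e' w0 w2] [w3 w4] w5 fr sc]; rewrite -[vs s0 1]/(vs s 1) v1 in ym.
  have [] := @scan_pair_correct (setv s' 6 y) j y ym e' w0 w2 w3 w4 w5 erefl sc.
  move=> sc' w4' fr'; split=> //.
  + by rewrite eval_ar // !eval_vs.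
  + by rewrite eval_vs.
  + by rewrite eval_vs.
  + by move=> a j' ne; rewrite fr' // fr.
Qed.

Lemma scan_correct s : ar s 0 = enc -> (forall a j, 0 < a < 8 -> ar s a j = 0) ->
  vs s 0 = n -> vs s 1 = m -> vs s 2 = 1 ->
  let s' := eval scan (eval matrix_end s) in
  [/\ forall j, j < m -> scanned (from_row 0) s' j, vs s' 1 = m, vs s' 2 = 1 &
      forall j, ar s' 1 j = 0 /\ ar s' 4 j = 0].
Proof.
move=> e z v0 v1 v2 /=.
set s0 := eval matrix_end s.
have ar0 a : ar s0 a = ar s a by rewrite /s0 eval_ar.
have v19 : vs s0 19 = 2 + n + m * n /\ vs s0 3 = 2 + n + m * n.
  rewrite /s0 /matrix_end !eval_then.
  set s1 := eval (Plus 3 3 0) _.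
  have u3 : vs s1 3 = 2 + vs s 0 by [].
  pose I x s' := vs s' 3 + x * n = 2 + n + m * n /\ vs s' 0 = n.
  have : I 0 (eval (For 5 1 (Plus 3 3 0)) s1).
    apply: for_ind.
      by split=> //; rewrite -[vs _ 3]/(vs s1 3) -[vs s1 1]/(vs s 1) u3 v0 v1.
    move=> x s' _ [h w0]; split=> //.
    by rewrite -[vs _ 3]/(vs s' 3 + vs s' 0) w0; lia.
  move: (eval _ s1) => s2 [h _].
  have {}h : vs s2 3 = 2 + n + m * n by rewrite -h addn0.
  by split; [rewrite -[LHS]/(vs s2 3 + 0) addn0|exact: h].
have [v19' v3] := v19.
pose I y s' := [/\ [/\ ar s' 0 = enc, vs s' 0 = n, vs s' 1 = m & vs s' 2 = 1],
  vs s' 3 = 2 + n + y * n, vs s' 19 = 2 + n + m * n,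
  (forall j, y <= j < m -> scanned (from_row 0) s' j) &
  forall a j, 0 < a < 8 -> j < y -> ar s' a j = 0].
have [[_ _ w1 w2] _ _ sc _] : I 0 (eval scan s0).
  apply: for_ind.
  - have -> : vs s0 1 = m by rewrite /s0 eval_vs.
    split=> //.
    + have vE v : v \in [:: 0; 1; 2] -> vs s0 v = vs s v.
        by rewrite !inE => /or3P[]/eqP->; rewrite /s0 eval_vs.
      by rewrite setv_ar ar0; split=> //; rewrite -[LHS]/(vs s0 _) vE.
    + by move=> j; rewrite leqNgt; case: ltnP.
    + by move=> a j a8 _; rewrite setv_ar ar0 z.
  - move=> y s' ym [[e' w0 w1 w2] w3 w19 sc zz].
    have {}ym : y < m by rewrite /s0 eval_vs // v1 in ym.
    have [] := @scan_row_correct (setv s' 5 y) y ym e' w0 w1 w2 w3 w19 erefl.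
    + by apply: zz.
    + by apply: zz.
    move=> sc' w3' fr; split=> //.
    + by rewrite eval_ar // !eval_vs.
    + by rewrite eval_vs.
    + move=> j /andP[yj jm]; case: (eqVneq j y) => [->//|ne].
      apply: scanned_ar (sc j _); last by lia.
      by move=> a; rewrite fr.
    + by move=> a j a8 jy; rewrite fr ?setv_ar ?zz //; [lia|rewrite neq_ltn jy].
by split=> // j; rewrite !eval_ar // !z.
Qed.
End Scan.

Lemma classify_correct m s : vs s 1 = m -> vs s 2 = 1 ->
  (forall j, ar s 1 j = 0 /\ ar s 4 j = 0) ->
  let s' := eval classify s in
  [/\ forall j, (ar s' 4 j != 0) = [&& j < m, ar s 5 j != 0, ar s 6 j != 0 &
         (ar s 3 j == m) || (ar s 5 (ar s 3 j) != 0)],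
      forall j, j < m -> (ar s' 1 j != 0) = (ar s 5 j == 0),
      forall j, ar s' 2 j = if j == m then m else ar s 2 j,
      forall j, ar s' 3 j = if j == m then m else ar s 3 j &
      vs s' 1 = m /\ vs s' 2 = 1].
Proof.
move=> v1 v2 z /=; rewrite /classify eval_then.
set s0 := eval _ s; set loop := For _ _ _.
have a2 j : ar s0 2 j = if j == m then m else ar s 2 j.
  by rewrite -v1 -[ar s0 2 j]/(upd (ar s 2) (vs s 1) (vs s 1) j).
have a3 j : ar s0 3 j = if j == m then m else ar s 3 j.
  by rewrite -v1 -[ar s0 3 j]/(upd (ar s 3) (vs s 1) (vs s 1) j).
have a5 j : ar s0 5 j = if j == m then 1 else ar s 5 j.
  by rewrite -[LHS]/(upd (ar s 5) (vs s 1) (vs s 2) j) v1 v2.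
have a6 j : ar s0 6 j = ar s 6 j by [].
pose lv j := [&& ar s0 5 j != 0, ar s0 6 j != 0 & ar s0 5 (ar s0 3 j) != 0].
pose I y s' := [/\ [/\ ar s' 3 = ar s0 3, ar s' 5 = ar s0 5 & ar s' 6 = ar s0 6], vs s' 2 = 1,
  (forall j, (ar s' 4 j != 0) = (y <= j < m) && lv j) &
  forall j, (ar s' 1 j != 0) = (y <= j < m) && (ar s0 5 j == 0)].
have [_ _ h4 h1] : I 0 (eval loop s0).
  apply: for_ind.
  - have -> : vs s0 1 = m by [].
    have z1 j : ar s0 1 j = 0 /\ ar s0 4 j = 0 by exact: z.
    have nj j : (m <= j < m) = false by lia.
    by split=> // j; have [e1 e4] := z1 j; rewrite setv_ar ?e1 ?e4 nj.
  - move=> y s' ym [[e3 e5 e6] w2 h4 h1]; have {}ym : y < m by rewrite -v1.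
    have yj j : (y <= j < m) = (j == y) || (y < j < m) by lia.
    split; first by split; rewrite eval_ar.
    + by rewrite eval_vs.
    + set t := setv s' 5 y; set body := (_ ;; _).
      have -> : ar (eval body t) 4 = if lv y then upd (ar s' 4) y 1 else ar s' 4.
        rewrite /body /lv -e3 -e5 -e6 eval_then eval_cond; set t1 := eval (Get 9 5 5) t.
        rewrite -[vs t1 9]/(ar s' 5 y); case: ifP => //= _.
        rewrite eval_then eval_cond; set t2 := eval (Get 10 6 5) t1.
        rewrite -[vs t2 10]/(ar s' 6 y); case: ifP => //= _.
        rewrite eval_then eval_cond; set t3 := eval _ t2.
        rewrite -[vs t3 11]/(ar s' 5 (ar s' 3 y)); case: ifP => // _.
        by rewrite -[LHS]/(upd (ar s' 4) y (vs s' 2)) w2.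
      move=> j; rewrite yj; case: (boolP (lv y)) => ly; rewrite /upd.
        by case: (eqVneq j y) => [->|_] /=; rewrite ?ly ?h4.
      rewrite h4; case: (eqVneq j y) => [->|_] //=.
      by rewrite (negPf ly) andbF.
    + set t := setv s' 5 y; set body := (_ ;; _).
      have -> : ar (eval body t) 1 = if ar s0 5 y == 0 then upd (ar s' 1) y 1 else ar s' 1.
        rewrite /body -e5 eval_then eval_cond; set t1 := eval (Get 9 5 5) t.
        rewrite -[vs t1 9]/(ar s' 5 y); case: ifPn => [/negPf->|/negbNE->].
          by rewrite eval_ar.
        by rewrite -[LHS]/(upd (ar s' 1) y (vs s' 2)) w2.
      move=> j; rewrite yj; case: (boolP (ar s0 5 y == 0)) => ly; rewrite /upd.
        by case: (eqVneq j y) => [->|_] /=; rewrite ?ly ?h1.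
      rewrite h1; case: (eqVneq j y) => [->|_] //=.
      by rewrite (negPf ly) andbF.
split.
- move=> j; rewrite h4 leq0n /lv !a5 a6 a3; case: (ltnP j m) => //= jm.
  by rewrite (ltn_eqF jm); case: (ar s 3 j == m).
- by move=> j jm; rewrite h1 leq0n jm a5 (ltn_eqF jm).
- by move=> j; rewrite eval_ar.
- by move=> j; rewrite eval_ar.
- by rewrite !eval_vs.
Qed.

Definition goodn (L P Q : nat -> nat) (j : nat) : bool :=
  [&& L j != 0, L (P j) != 0 & P j != Q j].

Lemma test_good_correct s g x : (g, x) \in [:: (13, 5); (14, 17)] ->
  (vs (eval (test_good g x) s) g != 0) = goodn (ar s 4) (ar s 2) (ar s 3) (vs s x).
Proof.
rewrite !inE /goodn => /orP[]/eqP[-> ->].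
all: rewrite /test_good eval_then eval_cond; set s1 := eval _ s.
- rewrite -[vs s1 9]/(ar s 4 (vs s 5)); case: ifP => _; rewrite ?andTb //.
  rewrite eval_then eval_cond; set s2 := eval _ s1.
  rewrite -[vs s2 11]/(ar s 4 (ar s 2 (vs s 5))); case: ifP => _; rewrite ?andTb //.
  set u := vs _ 13; rewrite (_ : u = (ar s 2 (vs s 5) - ar s 3 (vs s 5)) +
    (ar s 3 (vs s 5) - ar s 2 (vs s 5))) //; lia.
- rewrite -[vs s1 9]/(ar s 4 (vs s 17)); case: ifP => _; rewrite ?andTb //.
  rewrite eval_then eval_cond; set s2 := eval _ s1.
  rewrite -[vs s2 11]/(ar s 4 (ar s 2 (vs s 17))); case: ifP => _; rewrite ?andTb //.
  set u := vs _ 14; rewrite (_ : u = (ar s 2 (vs s 17) - ar s 3 (vs s 17)) +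
    (ar s 3 (vs s 17) - ar s 2 (vs s 17))) //; lia.
Qed.

Lemma consider_correct s m j : vs s 1 = m -> vs s 8 = 0 -> vs s 5 = j ->
  let gd := goodn (ar s 4) (ar s 2) (ar s 3) in
  vs (eval consider s) 15 =
    if gd j && (~~ gd (ar s 3 j) || (m <= vs s 15)) then j else vs s 15.
Proof.
move=> v1 v8 v5 /=; rewrite /consider eval_then eval_cond test_good_correct // v5.
case: ifP => g1; rewrite ?andTb; last by rewrite !eval_vs.
rewrite 2!eval_then; set s0 := eval (test_good 13 5) s; set s1 := eval (Get 17 3 5) s0.
have arE a : ar s1 a = ar s a by rewrite -[ar s1 a]/(ar s0 a) eval_ar.
have s17 : vs s1 17 = ar s 3 j.
  by rewrite -[vs s1 17]/(ar s0 3 (vs s0 5)) eval_ar // eval_vs // v5.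
have vsE v : v \in [:: 1; 5; 8; 15] -> vs (eval (test_good 14 17) s1) v = vs s v.
  by rewrite !inE => /or4P[]/eqP->; rewrite !eval_vs.
rewrite eval_cond test_good_correct // !arE s17.
move: (eval (test_good 14 17) s1) vsE => s2 vsE.
have pick : vs (eval (Plus 15 5 8) s2) 15 = j.
  by rewrite -[LHS]/(vs s2 5 + vs s2 8) !vsE // v5 v8 addn0.
case: ifP => _ //.
rewrite eval_then eval_cond; set s3 := eval _ s2.
rewrite -[vs s3 11]/(vs s2 1 - vs s2 15) !vsE // v1 -subn_eq0.
case: ifP => [/negPf->|/negbFE->]; first exact: vsE.
by rewrite -[LHS]/(vs s2 5 + vs s2 8) !vsE // v5 v8 addn0.
Qed.

Lemma greedy_round_correct s m : vs s 1 = m -> vs s 2 = 1 ->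
  let s' := eval greedy_round s in
  let P := ar s 2 in let Q := ar s 3 in let gd := goodn (ar s 4) P Q in
  exists c, [/\ (c = m /\ forall j, j < m -> ~~ gd j) \/
    [/\ c < m, gd c & ~~ gd (Q c) \/ forall j, j < m -> gd j -> gd (Q j)],
    forall x, ar s' 4 x = if x \in [:: c; P c; Q c; Q (P c)] then 0 else ar s 4 x &
    forall x, ar s' 1 x = if x \in [:: c; P c] then 1 else ar s 1 x].
Proof.
move=> v1 v2 s' P Q gd; rewrite {}/s' /greedy_round !eval_then.
set s0 := eval (Plus 15 1 8) _.
pose I y s' := [/\ forall a, ar s' a = ar s a, vs s' 1 = m /\ vs s' 2 = 1, vs s' 8 = 0 &
  (vs s' 15 = m /\ forall j, y <= j < m -> ~~ gd j) \/
  [/\ vs s' 15 < m, gd (vs s' 15) & ~~ gd (Q (vs s' 15)) \/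
     forall j, y <= j < m -> gd j -> gd (Q j)]].
have [e [w1 w2] w8 h] : I 0 (eval (For 5 1 consider) s0).
  apply: for_ind.
  - have -> : vs s0 1 = m by [].
    split=> //; left; split; first by rewrite -[LHS]/(vs s 1 + 0) v1 addn0.
    by move=> j; lia.
  - move=> y s' ym [e [w1 w2] w8 h]; have {}ym : y < m by rewrite -v1.
    have := @consider_correct (setv s' 5 y) m y w1 w8 erefl.
    rewrite setv_ar !e -/P -/Q -/gd => c15.
    have yj j : (y <= j < m) = (j == y) || (y < j < m) by lia.
    split.
    - by move=> a; rewrite eval_ar // setv_ar e.
    - by rewrite !eval_vs.
    - by rewrite eval_vs.
    rewrite c15 -[vs _ 15]/(vs s' 15); case: ifPn => [/andP[gy alt]|/nandP ngy].
      right; split=> //; case/orP: alt => [?|mc]; first by left.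
      case: (boolP (gd (Q y))) => gq; last by left.
      right=> j; rewrite yj => /orP[/eqP->//|jy gj].
      case: h => [[_ /(_ j jy)]|[]]; first by rewrite gj.
      by rewrite ltnNge mc.
    case: h => [[c ng]|[cm gc alt]]; [left|right]; split=> //.
      move=> j; rewrite yj => /orP[/eqP->|/ng//].
      by case: ngy => //; rewrite c leqnn orbT.
    case: alt => [?|alt]; [by left|right] => j; rewrite yj => /orP[/eqP->|/alt//] gy.
    by case: ngy; rewrite ?gy // negb_or negbK => /andP[].
set s1 := eval _ s0 in e w1 w2 w8 h *.
exists (vs s1 15); split.
- case: h => [[cm h]|[cm gc h]]; first by left.
  by right.
- move=> x; set c := vs s1 15.
  have -> : ar (eval commit s1) 4 = upd (upd (upd (upd (ar s1 4) c (vs s1 8))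
      (ar s1 2 c) (vs s1 8)) (ar s1 3 c) (vs s1 8)) (ar s1 3 (ar s1 2 c)) (vs s1 8) by [].
  by rewrite !e w8 -/P -/Q !inE /upd; do ?[case: (x == _) => //].
- move=> x; set c := vs s1 15.
  have -> : ar (eval commit s1) 1 = upd (upd (ar s1 1) c (vs s1 2)) (ar s1 2 c) (vs s1 2) by [].
  by rewrite !e w2 -/P !inE /upd; do ?[case: (x == _) => //].
Qed.

(** * Correctness *)

Section Instance.
Variables (n m : nat) (T : {set 'I_n}) (S : 'I_m -> {set 'I_n}).
Notation enc := (encode T S).

Lemma encode_bit x : 2 <= x -> enc x <= 1.
Proof.
case: x => [|[|x]] // _; rewrite /encode /=.
case: ifP => _; first by case: insub => // i; case: (_ \in _).
case: ifP => // _; case: insub => // j; case: insub => // i.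
by case: (_ \in _).
Qed.

Lemma encode_end x : 2 + n + m * n <= x -> enc x = 0.
Proof.
move=> h; rewrite /encode (_ : x == 0 = false); last by lia.
rewrite (_ : x == 1 = false); last by lia.
rewrite (_ : x < 2 + n = false); last by lia.
by rewrite (_ : x < 2 + n + m * n = false) //; lia.
Qed.

Lemma encode_target (i : 'I_n) : tb enc i = (i \in T).
Proof.
rewrite /tb /encode ltn_add2l ltn_ord addKn valK /=.
by case: (i \in T).
Qed.

Lemma encode_exemplar (j : 'I_m) (i : 'I_n) : sb n enc j i = (i \in S j).
Proof.
have lt : j * n + i < m * n.
  have : j.+1 * n <= m * n by rewrite leq_mul2r ltn_ord orbT.
  by have := ltn_ord i; rewrite mulSn; lia.
have n0 : 0 < n := leq_ltn_trans (leq0n i) (ltn_ord i).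
rewrite /sb; set x := _ + i.
have -> : enc x = if x < 2 + n then 0 else if x < 2 + n + m * n then
    (let y := x - (2 + n) in
       match insub (y %/ n), insub (y %% n) with
       | Some j, Some i => nat_of_bool (i \in S j)
       | _, _ => 0
       end) else 0.
  rewrite /encode (_ : x == 0 = false); last by rewrite /x; lia.
  rewrite (_ : x == 1 = false); last by rewrite /x; lia.
  by rewrite (_ : x < 2 + n = false) //; rewrite /x; lia.
rewrite (_ : x < 2 + n = false); last by rewrite /x; lia.
rewrite (_ : x < 2 + n + m * n); last by rewrite /x -addnA ltn_add2l.
rewrite /= (_ : x - (2 + n) = j * n + i); last by rewrite /x; lia.
rewrite divnMDl // divn_small ?ltn_ord // addn0 modnMDl modn_small ?ltn_ord //.
by rewrite !valK; case: (i \in S j).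
Qed.

Let E := 'I_m.+1.

(* One more exemplar, empty, plays the role of a missing partner. *)
Definition Sx (j : E) : {set 'I_n} := if insub (val j) is Some j' then S j' else set0.

Lemma SxE (j : E) (i : 'I_n) : (i \in Sx j) = (j < m) && sb n enc j i.
Proof.
rewrite /Sx; case: insubP => [j' jm e|/negPf->]; last by rewrite inE.
by rewrite jm -encode_exemplar e.
Qed.

Lemma widen_inj : injective (widen_ord (leqnSn m)).
Proof. by move=> j k /(congr1 val) /= /val_inj. Qed.

Lemma Sx_widen (j : 'I_m) : Sx (widen_ord (leqnSn m) j) = S j.
Proof. by rewrite /Sx /= valK. Qed.

Lemma colE b (j : E) k (i : 'I_n) : feature T Sx b j i = (j < m) && mono_at n enc b j k i.
Proof. by rewrite /feature SxE /mono_at encode_target andbC -andbA. Qed.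

Hypotheses (occ : k_occurrence 2 S) (wt : w_weight 2 S).

Lemma Sx_occ i : #|[set j | i \in Sx j]| <= 2.
Proof.
apply: leq_trans (occ i).
rewrite -(card_imset _ widen_inj); apply: subset_leq_card.
apply/subsetP=> j; rewrite inE /Sx; case: insubP => [j' jm e|]; last by rewrite inE.
move=> ij; apply/imsetP; exists j'; rewrite ?inE //; exact: val_inj.
Qed.

Lemma Sx_wt j : #|Sx j| <= 2.
Proof. by rewrite /Sx; case: insub => [j'|]; [exact: wt|rewrite cards0]. Qed.

Notation full := (from_row n m 0).

Lemma hit_has_col b (j : E) x : j < m ->
  hit full 0 (mono_at n enc b j) (fun => 1) x -> has_col T Sx b j = (x != 0).
Proof.
move=> jm [[-> h]|[k [i [/andP[iN km] c ->]]]].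
  apply/existsP=> -[i]; rewrite (colE _ _ j) jm /= => c.
  by have := h j i; rewrite c /from_row ltn_ord jm => /(_ isT).
by apply/existsP; exists (Ordinal iN); rewrite (colE _ _ k) jm.
Qed.

Lemma sharesE b (j k : E) : j != k ->
  shares T Sx b j k = [&& j < m, k < m & [exists i : 'I_n, meet_at n enc b j k i]].
Proof.
move=> jk; apply/existsP/and3P => [[i /andP[]]|[jm km /existsP[i]]].
  rewrite !(colE _ _ k) => /andP[jm c] /andP[km /andP[sk _]]; split=> //.
  by apply/existsP; exists i; rewrite /meet_at c sk.
rewrite /meet_at => /and3P[c sk _]; exists i; rewrite !(colE _ _ k) jm km c /=.
by rewrite /mono_at sk; case/andP: c => _ ->.
Qed.

Lemma hit_partner b (j : E) x : j < m ->
  hit full m (meet_at n enc b j) id x ->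
  (x = m /\ forall k : E, k != j -> ~~ shares T Sx b j k) \/
  [/\ x < m, x != j & shares T Sx b j (inord x)].
Proof.
move=> jm [[-> h]|[k [i [/andP[iN km] c ->]]]]; [left|right].
  split=> // k kj; rewrite sharesE 1?eq_sym //; apply/negP=> /and3P[_ km /existsP[i c]].
  by have := h k i; rewrite c /from_row ltn_ord km => /(_ isT).
have jk : (j : nat) != k by case/and3P: c.
have {}km : k < m by case/andP: km.
have kE : (inord k : E) = k :> nat by rewrite inordK // ltnW.
split; [exact: km|by rewrite eq_sym|rewrite sharesE].
  by rewrite jm kE km; apply/existsP; exists (Ordinal iN).
by apply: contraNneq jk => ->; rewrite kE.
Qed.

Section Greedy.
Variables s1 s2 : state.
Hypothesis scan1 : forall j, j < m -> scanned n m enc full s1 j.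
Hypothesis live2 : forall j, (ar s2 4 j != 0) = [&& j < m, ar s1 5 j != 0, ar s1 6 j != 0 &
         (ar s1 3 j == m) || (ar s1 5 (ar s1 3 j) != 0)].
Hypothesis out2 : forall j, j < m -> (ar s2 1 j != 0) = (ar s1 5 j == 0).
Hypothesis P2 : forall j, ar s2 2 j = if j == m then m else ar s1 2 j.
Hypothesis Q2 : forall j, ar s2 3 j = if j == m then m else ar s1 3 j.

Notation P := (ar s2 2).
Notation Q := (ar s2 3).
Definition pE (j : E) : E := inord (P j).
Definition qE (j : E) : E := inord (Q j).
Definition live_set (s : state) : {set E} := [set j : E | ar s 4 j != 0].

Lemma partners_le (j : E) : P j <= m /\ Q j <= m.
Proof.
rewrite P2 Q2; case: eqP => // jm.
have {}jm : j < m by have := ltn_ord j; lia.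
have [_ _ hP hQ] := scan1 jm; split.
  by case: (hit_partner jm hP) => [[-> _]|[/ltnW]].
by case: (hit_partner jm hQ) => [[-> _]|[/ltnW]].
Qed.

Lemma pE_val (j : E) : pE j = P j :> nat.
Proof. by rewrite /pE inordK // ltnS; have [] := partners_le j. Qed.

Lemma qE_val (j : E) : qE j = Q j :> nat.
Proof. by rewrite /qE inordK // ltnS; have [] := partners_le j. Qed.

Lemma live_lt (j : E) : j \in live T Sx -> j < m.
Proof.
by move=> /(live_has true)/existsP[i]; rewrite (colE _ _ 0) => /andP[].
Qed.

(** The program tests one recorded blue partner where [live] quantifies over all exemplars; the
    bounds on occurrence and weight make that partner the only one. *)
Lemma live_setE : live_set s2 = live T Sx.
Proof.
apply/setP=> j; rewrite inE live2; case: (ltnP j m) => jm /=; last first.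
  by apply/esym/negbTE/negP=> /live_lt; rewrite ltnNge jm.
have [h5 h6 _ h3] := scan1 jm.
rewrite inE (hit_has_col jm h5) (hit_has_col jm h6) andbCA.
case: (boolP (ar s1 6 j != 0)) => //= _; case: (boolP (ar s1 5 j != 0)) => //= r5.
have cf : has_col T Sx false j by rewrite (hit_has_col jm h5).
case: (hit_partner jm h3) => [[-> no]|[xm xj sx]].
  rewrite eqxx; apply/esym/forallP=> k; apply/implyP=> kj.
  by rewrite (negPf (no _ kj)).
rewrite (ltn_eqF xm) /=; set k0 : E := inord _ in sx.
have k0v : k0 = ar s1 3 j :> nat by rewrite inordK // ltnW.
have k0m : k0 < m by rewrite k0v.
have k0j : k0 != j by apply: contra xj => /eqP e; rewrite -k0v e.
have [h5' _ _ _] := scan1 k0m; rewrite -k0v -(hit_has_col k0m h5').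
apply/idP/forallP=> [h k|/(_ k0)]; last by rewrite k0j sx.
apply/implyP=> kj; apply/implyP=> sk.
by rewrite (@shares_uniq _ _ _ _ Sx_occ Sx_wt true _ _ _ cf kj k0j sk sx).
Qed.

Lemma ord_max_not_live : (ord_max : E) \notin live T Sx.
Proof. by apply/negP=> /live_lt; rewrite /= ltnn. Qed.

(** The default [m] of the scan becomes [ord_max], which is never live because its exemplar is
    empty. *)
Lemma partner_of_hit b (f : nat -> nat) (g : E -> E) :
  (forall j : E, g j = f j :> nat) ->
  (forall j, j < m -> hit full m (meet_at n enc b j) id (f j)) ->
  partner_map T Sx b g.
Proof.
move=> gf hf j jl; have jm := live_lt jl.
have [[e no]|[xm xj sx]] := hit_partner jm (hf _ jm).
  have gm : g j = ord_max by apply: val_inj; rewrite /= gf e.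
  rewrite gm; split; last by right; split; [exact: ord_max_not_live|].
  by rewrite -(inj_eq val_inj) /= gtn_eqF.
rewrite -(inj_eq val_inj) /= gf; split=> //; left.
by rewrite -gf inord_val in sx.
Qed.

Lemma pE_partner : partner_map T Sx false pE.
Proof.
apply: (@partner_of_hit _ P) pE_val _ => j jm.
by have [_ _ h _] := scan1 jm; rewrite P2 (ltn_eqF jm).
Qed.

Lemma qE_partner : partner_map T Sx true qE.
Proof.
apply: (@partner_of_hit _ Q) qE_val _ => j jm.
by have [_ _ _ h] := scan1 jm; rewrite Q2 (ltn_eqF jm).
Qed.

Lemma pureE (j : E) : j < m -> (j \in pure T Sx) = (ar s2 1 j != 0).
Proof.
move=> jm; have [h5 _ _ _] := scan1 jm.
by rewrite inE (hit_has_col jm h5) negbK out2.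
Qed.

Lemma goodnE s (j : E) : goodn (ar s 4) P Q j = good pE qE (live_set s) j.
Proof. by rewrite /good !inE -(inj_eq val_inj) /= pE_val qE_val. Qed.

(** With [y] rounds left, either at most [y] live exemplars remain or the selection is already
    complete; at [y = 0] both alternatives leave no good element. *)
Definition greedy_state (y : nat) (s : state) : Prop :=
  [/\ vs s 1 = m /\ vs s 2 = 1, ar s 2 = P /\ ar s 3 = Q &
   exists Y, [/\ greedy_inv pE qE (live T Sx) (live_set s) Y,
     [disjoint Y & live_set s],
     forall j : E, j < m -> (ar s 1 j != 0) = (j \in pure T Sx) || (j \in Y) &
     #|live_set s| <= y \/ forall j, ~~ good pE qE (live_set s) j]].

Lemma greedy_state_round y s : greedy_state y.+1 s ->
  greedy_state y (eval greedy_round s).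
Proof.
move=> [[w1 w2] [eP eQ] [Y [inv dis out cnt]]].
split; [by rewrite !eval_vs|by rewrite !eval_ar|].
have [c] := greedy_round_correct w1 w2; rewrite eP eQ => -[alt l4 l1].
have sub : live_set s \subset live T Sx by have [] := inv.
have omax : ar s 4 m = 0.
  by have := contra (subsetP sub ord_max) ord_max_not_live; rewrite inE negbK => /eqP.
have PQm : P m = m /\ Q m = m by rewrite P2 Q2 eqxx.
case: alt => [[cm no]|[cm gc alt]].
  (* An idle round writes only at index [m], where the live table is already zero. *)
  have same : live_set (eval greedy_round s) = live_set s.
    apply/setP=> j; rewrite !inE l4 cm; have [-> ->] := PQm; rewrite !inE !orbb.
    by case: (eqVneq (nat_of_ord j) m) => [->|//]; rewrite omax.
  exists Y; rewrite same; split=> //.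
    move=> j jm; rewrite l1 cm; have [-> _] := PQm; rewrite -out //.
    by rewrite !inE orbb (ltn_eqF jm).
  right=> j; rewrite -goodnE; case: (ltnP j m) => [/no//|jm].
  have -> : j = m :> nat by have := ltn_ord j; lia.
  by rewrite /goodn omax.
pose c0 : E := Ordinal (leqW cm).
have gc0 : good pE qE (live_set s) c0 by rewrite -goodnE.
have inE4 (j : E) : (nat_of_ord j \in [:: c; P c; Q c; Q (P c)]) =
    [|| j == c0, j == pE c0, j == qE c0 | j == qE (pE c0)].
  by rewrite !inE -!(inj_eq val_inj) /= !qE_val !pE_val.
have rem : live_set (eval greedy_round s) = remaining pE qE (live_set s) c0.
  apply/setP=> j; rewrite in_remaining !inE l4 inE4.
  by do !case: (j == _) => //=.
have alt0 : ~~ good pE qE (live_set s) (qE c0) \/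
    forall j, good pE qE (live_set s) j -> good pE qE (live_set s) (qE j).
  case: alt => [h|h]; [left|right=> j]; rewrite -?goodnE ?qE_val // => gj.
  apply: h => //; apply: live_lt; apply: (subsetP sub).
  by move: gj; rewrite goodnE => /and3P[].
have [inv' dis'] := greedy_step
  (partnered_live Sx_occ Sx_wt pE_partner qE_partner) inv gc0 alt0 dis.
exists (Y :|: [set c0; pE c0]); rewrite rem; split=> //.
  move=> j jm.
  have -> : (j \in Y :|: [set c0; pE c0]) = (j \in Y) || (nat_of_ord j \in [:: c; P c]).
    by rewrite !inE -!(inj_eq val_inj) /= pE_val.
  by rewrite l1 orbA -out //; case: ifP => _; rewrite ?orbT ?orbF.
(* At least [c0] leaves the live set, which pays for the round. *)
left; case: cnt => [cnt|/(_ c0)]; last by rewrite gc0.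
rewrite -ltnS; apply: leq_trans cnt; apply: proper_card.
rewrite properE remaining_sub; apply/subsetPn; exists c0.
  by case/and3P: gc0.
by rewrite in_remaining eqxx.
Qed.

Lemma greedy_state_optimal s : greedy_state 0 s ->
  optimal T S [set j : 'I_m | ar s 1 j != 0].
Proof.
move=> [_ _ [Y [[_ fY _ opt] _ out cnt]]].
have none j : ~~ good pE qE (live_set s) j.
  case: cnt => [|//]; rewrite leqn0 cards_eq0 => /eqP->.
  by rewrite /good inE.
have maxY Z : feasible pE qE (live T Sx) Z -> #|Z| <= #|Y|.
  by move=> /opt[Z' /feasible_not_good/(_ none)->]; rewrite cards0 addn0.
move=> A.
have eA : appearing S A = covered Sx (widen_ord (leqnSn m) @: A).
  apply/setP=> i; apply/bigcupP/bigcupP=> [[j jA ij]|[j /imsetP[k kA ->]]].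
    by exists (widen_ord (leqnSn m) j); rewrite ?imset_f ?Sx_widen.
  by rewrite Sx_widen => ik; exists k.
have eY : appearing S [set j : 'I_m | ar s 1 j != 0] = covered Sx (pure T Sx :|: Y).
  apply/setP=> i; apply/bigcupP/bigcupP=> [[j jA ij]|[j jA ij]].
    exists (widen_ord (leqnSn m) j); rewrite ?Sx_widen //.
    have oj := out (widen_ord (leqnSn m) j) (ltn_ord j).
    by rewrite in_setU -oj; move: jA; rewrite inE.
  have jm : j < m by move: ij; rewrite SxE => /andP[].
  exists (Ordinal jm); first by rewrite inE /= out // -in_setU.
  by rewrite -Sx_widen (_ : widen_ord _ _ = j) //; apply: val_inj.
have := feasible_max_margin Sx_occ Sx_wt pE_partner qE_partner (widen_ord (leqnSn m) @: A) fY maxY.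
rewrite /margin eA eY; lia.
Qed.

End Greedy.

Lemma main_correct s : ar s 0 = enc -> (forall a j, 0 < a < 8 -> ar s a j = 0) ->
  vs s 0 = n -> vs s 1 = m -> vs s 2 = 1 ->
  optimal T S [set j : 'I_m | ar (eval main s) 1 j != 0].
Proof.
move=> e z v0 v1 v2.
have [sc1 w1 w2 z1] := @scan_correct n m enc s e z v0 v1 v2.
rewrite /main 3!eval_then; set s1 := eval scan _ in sc1 w1 w2 z1 *.
have [lv ou pp qq [u1 u2]] := classify_correct w1 w2 z1.
set s2 := eval classify s1 in lv ou pp qq u1 u2 *.
apply: (@greedy_state_optimal s1 s2) => //.
apply: (@for_ind (greedy_state s2)); last first.
  move=> y s' _ h; exact: (greedy_state_round (s := setv s' 18 y) sc1 pp qq h).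
rewrite u1; split=> //.
exists set0.
have -> : live_set (setv s2 18 m) = live T Sx by rewrite -(live_setE sc1 lv).
split.
- exact: greedy_inv0.
- by apply/pred0P=> j /=; rewrite inE.
- by move=> j jm; rewrite (pureE sc1 ou) // inE orbF.
- left; apply: (@leq_trans #|[set widen_ord (leqnSn m) j | j : 'I_m]|).
    apply: subset_leq_card; apply/subsetP=> j /live_lt jm.
    by apply/imsetP; exists (Ordinal jm) => //; exact: val_inj.
  by rewrite (leq_trans (leq_imset_card _ _)) // card_ord.
Qed.
End Instance.

Definition solver : rc :=
  RSeq boot (RSeq (trans load_sizes) (RSeq (trans main) epilogue)).

(* There is a fixed RAM program and a polynomial bound c * (n+m+1)^k such
   that on every 2-occurrence, 2-weight TAP instance the program halts
   within that many steps and outputs a maximum-margin subcollection. *)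
Theorem theorem9 :
  exists (prog : seq instr) (c k : nat),
    forall (n m : nat) (T : {set 'I_n}) (S : 'I_m -> {set 'I_n}),
      valid_instance T S ->
      k_occurrence 2 S ->
      w_weight 2 S ->
      exists M : memory,
        run (c * (n + m + 1) ^ k) prog 0 (encode T S) = Some M /\
        optimal T S (decode m M).
Proof.
pose K := cost 1 main; pose d := depth main.
(* With [N = n + m + 1], [main] takes at most [K * N ^ d] steps. Relocation, loading and output take
   a constant times [N ^ 2], because [base] is at most [24 * N ^ 2]; [400] is a generous value for
   that constant, and [d.+2] dominates both exponents. *)
exists (assemble 0 solver), (K + 400), d.+2 => n m T S _ occ wt.
set enc := encode T S; pose D := base n m.
have D24 : 24 <= D := base_ge n m.
have [M1 [t1 [x1 b1 M10 M11 M1a]]] :=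
  @boot_exec n m enc erefl erefl (@encode_bit n m T S) (@encode_end n m T S).
pose s1 := State (fun v => M1 (reg v)) (fun a => if a == 0 then enc else fun=> 0).
have R1 : represents D s1 M1 by split=> //= a i a8; rewrite M1a //; case: eqP.
have [//|M2 [t2 [x2 R2 b2]]] := @trans_exec D D24 [::] 0 load_sizes isT isT s1 M1 R1.
set s2 := eval load_sizes s1 in R2.
have [v0 v1 v2] : [/\ vs s2 0 = n, vs s2 1 = m & vs s2 2 = 1].
  by [].
have [|M3 [t3 [x3 R3 b3]]] := @trans_exec D D24 [:: 0; 1] (n + m) main isT isT s2 M2 R2.
  by move=> b; rewrite !inE => /orP[]/eqP->; rewrite ?v0 ?v1 ?leq_addr ?leq_addl.
have w1 : vs (eval main s2) 1 = m by rewrite eval_vs.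
have [|M4 [t4 [x4 b4 out]]] := epilogue_exec D24 R3.
  by rewrite w1 /D /base; lia.
exists M4; split.
  apply: exec_program; first by apply: ExSeq x1 (ExSeq x2 (ExSeq x3 x4)).
  rewrite w1 in b4; set N := n + m + 1.
  have hK : cost (n + m) main <= K * N ^ d by rewrite /N addn1; exact: cost_poly.
  have pos : 0 < N ^ d by rewrite expn_gt0 /N addn1.
  have hN : 0 < N by rewrite /N addn1.
  have bD : D <= 24 * N ^ 2 by rewrite /D /base /N; nia.
  have h2 : 0 < N ^ 2 by rewrite expn_gt0 hN.
  have hd2 : N ^ d <= N ^ d.+2 by rewrite leq_pexp2l // -addn2 leq_addr.
  have h22 : N ^ 2 <= N ^ d.+2 by rewrite leq_pexp2l.
  have mN : m <= N ^ 2 by rewrite /N; nia.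
  have t2b : t2 <= 16 by exact: b2.
  have hKd : K * N ^ d <= K * N ^ d.+2 by rewrite leq_mul2l hd2 orbT.
  rewrite -/D in b1; rewrite mulnDl.
  have {}b3 := leq_trans b3 (leq_trans hK hKd).
  move: (K * N ^ d.+2) (N ^ d.+2) b3 h22 => a b b3 h22.
  move: (N ^ 2) bD h2 mN h22 => c bD h2 mN h22.
  move: b1 t2b b3 b4 bD h2 mN h22; clear; lia.
suff -> : decode m M4 = [set j : 'I_m | ar (eval main s2) 1 j != 0].
  apply: main_correct => //.
  by move=> a j /andP[a0 _]; rewrite eval_ar //= gtn_eqF.
by apply/setP=> j; rewrite !inE out // w1.
Qed.
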